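(* Let $\Omega \subset \mathbb R^d$ be a nonempty, open, bounded, connected set whose boundary $\partial\Omega$ is a compact $\mathbf C^{1,1}$ submanifold of $\mathbb R^d$ of dimension $d-1$, let $\Gamma \subset \bar\Omega$ be nonempty and closed, and let $k: \mathbb R_+ \times \bar\Omega \to \mathbb R_+$ be continuous with values in $[K_{\min}, K_{\max}]$ for some positive constants $K_{\min}, K_{\max}$ and such that $|k(t,x_1) - k(t,x_2)| \le L|x_1 - x_2|$ for all $t \in \mathbb R_+$, $x_1, x_2 \in \bar\Omega$, for some $L > 0$. Consider the optimal control problem $\mathrm{OCP}(k)$ with value function $\varphi$. Let $(t_0, x_0) \in \mathbb R_+ \times \bar\Omega$, $\gamma \in \mathrm{Opt}(k, t_0, x_0)$, $T = \varphi(t_0, x_0)$, and let $u: \mathbb R_+ \to \bar B$ be an optimal control associated with $\gamma$. Then, up to redefining $u$ in a set of Lebesgue measure zero, we have $\gamma \in \mathbf C^1([t_0, t_0 + T]; \bar\Omega)$ and $u$ is a Lipschitz continuous function from $[t_0, t_0 + T]$ to $\mathbb S^{d-1}$.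
   Context: $\mathbb R_+ = [0,\infty)$, $\bar B$ is the closed unit ball and $\mathbb S^{d-1}$ the unit sphere of $\mathbb R^d$. $\mathrm{Adm}(k)$ is the set of Lipschitz continuous $\gamma: \mathbb R_+ \to \bar\Omega$ for which there is a measurable $u: \mathbb R_+ \to \bar B$ (the control associated with $\gamma$) with $\dot\gamma(t) = k(t, \gamma(t)) u(t)$ for a.e. $t \ge 0$. For a Lipschitz curve $\gamma$ and $t_0 \ge 0$, $\tau(t_0, \gamma) = \inf\{t \ge 0 : \gamma(t + t_0) \in \Gamma\}$ ($+\infty$ if there is no such $t$). The value function of $\mathrm{OCP}(k)$ is $\varphi(t_0, x_0) = \inf\{\tau(t_0, \gamma) : \gamma \in \mathrm{Adm}(k),\ \gamma(t_0) = x_0\}$. $\mathrm{Opt}(k, t_0, x_0)$ is the set of $\gamma \in \mathrm{Adm}(k)$ such that $\gamma(t) = x_0$ for $t \in [0, t_0]$, $\tau(t_0, \gamma) = \varphi(t_0, x_0)$, and $\gamma(t) = \gamma(t_0 + \tau(t_0, \gamma))$ for all $t \ge t_0 + \tau(t_0, \gamma)$; the control associated with such a $\gamma$ is called an optimal control. *)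

(* Defs.v *)
From HB Require Import structures.
From mathcomp Require Import all_boot all_order all_algebra.
From mathcomp Require Import all_classical all_reals all_analysis.
From mathcomp Require Import measurable_realfun.

Set Implicit Arguments.
Unset Strict Implicit.
Unset Printing Implicit Defensive.

Import Order.TTheory GRing.Theory Num.Theory.
Import numFieldNormedType.Exports.

Local Open Scope classical_set_scope.
Local Open Scope ring_scope.

(* The library norm on 'rV[R]_n is the sup norm. It induces the same topology,
   bounded sets and derivatives as the Euclidean norm, but the unit ball and
   sphere in which controls take their values must be the Euclidean ones. *)
Definition enorm (R : realType) (n : nat) (x : 'rV[R]_n) : R :=
  Num.sqrt (\sum_(i < n) x ord0 i ^+ 2).

Definition eclosed_ball (R : realType) (n : nat) : set 'rV[R]_n :=
  [set x | enorm x <= 1].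

Definition esphere (R : realType) (n : nat) : set 'rV[R]_n :=
  [set x | enorm x = 1].

Definition frontier (T : topologicalType) (A : set T) : set T :=
  closure A `\` interior A.

Section submanifold.
Context {R : realType}.

Definition C11_on (n m : nat) (U : set 'rV[R]_n) (f : 'rV[R]_n -> 'rV[R]_m) :=
  (forall x, U x -> differentiable f x) /\
  exists M : R, forall x y, U x -> U y -> forall v : 'rV[R]_n,
    enorm ('d f x v - 'd f y v) <= M * enorm (x - y) * enorm v.

Definition C11_diffeo (n : nat) (U V : set 'rV[R]_n)
    (f g : 'rV[R]_n -> 'rV[R]_n) :=
  [/\ C11_on U f, C11_on V g,
      (forall x, U x -> V (f x) /\ g (f x) = x) &
      (forall y, V y -> U (g y) /\ f (g y) = y)].

(* Local straightening: near each of its points, M is mapped by a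
   C^{1,1} diffeomorphism between open sets U and V of R^n onto
   V `&` (R^m x {0}). *)
Definition C11_submanifold (n m : nat) (M : set 'rV[R]_n) :=
  (m <= n)%N /\
  forall p, M p -> exists U V : set 'rV[R]_n,
    [/\ open U, U p, open V &
      exists f g : 'rV[R]_n -> 'rV[R]_n,
        C11_diffeo U V f g /\
        forall x, U x -> (M x <-> forall i : 'I_n, (m <= i)%N -> f x ord0 i = 0)].

End submanifold.

Section curves.
Context {R : realType} {d : nat}.
Implicit Types (S : set R) (f : R -> 'rV[R]_d).

Definition elipschitz_on S f :=
  exists M : R, forall s t, S s -> S t -> enorm (f s - f t) <= M * `|s - t|.

(* Derivatives are taken within S, hence one-sided at the end points of an
   interval. *)
Definition C1_on S f :=
  exists f' : R -> 'rV[R]_d,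
    {within S, continuous f'} /\
    forall t, S t ->
      (fun s => (s - t)^-1 *: (f s - f t)) @ within S (dnbhs t) --> f' t.

(* Lebesgue (not merely Borel) measurability on R_+: the source carries the
   completion of the Borel sigma-algebra. *)
Definition lebesgue_measurable_Rplus f :=
  forall i : 'I_d,
    @measurable_fun _ _
      (g_sigma_algebraType (completed_algebra_gen (@lebesgue_measure R)))
      (measurableTypeR R) [set t : R | 0 <= t] (fun t => f t ord0 i).

End curves.

(* A function on R_+ (resp. on R_+ x closure Omega) is represented by a total
   function whose values outside that domain are never constrained or used. *)
Section optimal_control.
Context {R : realType} {d : nat}.
Variables (Omega Gamma : set 'rV[R]_d) (k : R -> 'rV[R]_d -> R).
Implicit Types gamma u : R -> 'rV[R]_d.

Definition associated_control gamma u :=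
  [/\ lebesgue_measurable_Rplus u,
      (forall t, 0 <= t -> eclosed_ball (u t)) &
      {ae @lebesgue_measure R, forall t : R,
         0 <= t -> is_derive t (1 : R) gamma (k t (gamma t) *: u t)}].

Definition Adm : set (R -> 'rV[R]_d) :=
  [set gamma | [/\ (forall t, 0 <= t -> closure Omega (gamma t)),
                   elipschitz_on [set t | 0 <= t] gamma &
                   exists u, associated_control gamma u]].

Definition exit_time (t0 : R) gamma : \bar R :=
  ereal_inf [set t%:E | t in [set t : R | 0 <= t /\ Gamma (gamma (t + t0))]].

Definition value (t0 : R) (x0 : 'rV[R]_d) : \bar R :=
  ereal_inf [set exit_time t0 gamma |
    gamma in [set gamma | Adm gamma /\ gamma t0 = x0]].

Definition Opt (t0 : R) (x0 : 'rV[R]_d) : set (R -> 'rV[R]_d) :=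
  [set gamma | [/\ Adm gamma,
    (forall t, 0 <= t <= t0 -> gamma t = x0),
    exit_time t0 gamma = value t0 x0 &
    (forall t, (t0%:E + exit_time t0 gamma <= t%:E)%E ->
       gamma t = gamma (t0 + fine (exit_time t0 gamma)))]].

End optimal_control.

(* [t0, t0 + T] for an extended real T; it is [t0, +oo[ when T = +oo. *)
Definition time_interval (R : realType) (t0 : R) (T : \bar R) : set R :=
  [set t | t0 <= t /\ (t%:E <= t0%:E + T)%E].

(* Main.v *)
Require Import Defs.
From HB Require Import structures.
From mathcomp Require Import all_boot all_order all_algebra.
From mathcomp Require Import all_classical all_reals all_analysis.
From mathcomp Require Import measurable_realfun.
From mathcomp Require Import ring lra.
Import Order.TTheory GRing.Theory Num.Theory.
Import numFieldNormedType.Exports.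
Local Open Scope classical_set_scope.
Local Open Scope ring_scope.

(** The idea is to compare an optimal curve with its own chords.  Let [A] be the
    integral of the speed limit [k t (gamma t)] along the optimal curve [gamma].
    Then [gamma] covers at most the distance [l = A t - A s] between the times [s]
    and [t].

    The boundary being of class C^{1,1}, a chord of length [h] between two points of
    the closure of the domain leaves the closure by at most [O(h ^ 2)].  Pushing it
    back along a fixed transversal direction and removing the tangential part of the
    displacement gives a parabola that remains in the closure and has length
    [h + O(h ^ 3)] ([pushed_chord], [uniform_bent_chord]).

    Optimality enters through [no_advance]: no admissible curve starting at [x0] at
    the time [t0] reaches a point [gamma t] of the optimal curve before the time [t],
    since it could keep its advance up to the target, the speed limit being Lipschitz
    in space.  The competitor travelling along the parabola from [gamma s] to
    [gamma t] is as far from [gamma] as the deviation [D] of [gamma] from its chord,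
    up to [O(l ^ 2)], hence its speed limit is at least [1 - O(D + l ^ 2)] times the
    one of [gamma].  Since it does not arrive early, [l - h <= l * O(D + l ^ 2)]
    ([shortcut]).  On the other hand, by Stewart's identity, [D ^ 2] is at most a
    quarter of [l ^ 2 - h ^ 2].  Both together give [D = O(l ^ 2)] and
    [l ^ 2 - h ^ 2 = O(l ^ 4)] ([deviation_bound]).

    A deviation quadratic in the length means that the difference quotients of
    [gamma] with respect to [A] change by [O(l)] when the interval is halved.  At the
    times where [gamma] has the derivative [k t (gamma t) *: u t], they converge to
    [u t], so that [u] is Lipschitz on a set of full measure ([control_lipschitz_ae]);
    it has norm 1 there because the chords are almost as long as [l]
    ([control_unit]).  The Lipschitz extension of [u] is the required representative,
    and the quadratic estimate makes it the direction of the derivative of [gamma] at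
    every time ([regular_control]).

    Two facts complete the argument.  The inequality [enorm (gamma t - gamma s) <= l]
    is a mean value inequality for Lipschitz functions ([gamma_increment]).  The value
    is finite because chains of bent chords join any two points of the closure of the
    domain, which is connected ([reach_everywhere]). *)

(** * Euclidean inner product and norm *)

Section euclidean.
Set Implicit Arguments.
Unset Strict Implicit.
Context {R : realType} {n : nat}.
Implicit Types (x y z w : 'rV[R]_n) (a : R).

Definition dot x y : R := \sum_(i < n) x ord0 i * y ord0 i.

Lemma dotC x y : dot x y = dot y x.
Proof. by apply: eq_bigr => i _; rewrite mulrC. Qed.

Lemma dotDl x y z : dot (x + y) z = dot x z + dot y z.
Proof. by rewrite -big_split; apply: eq_bigr => i _; rewrite !mxE mulrDl. Qed.

Lemma dotZl a x y : dot (a *: x) y = a * dot x y.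
Proof. by rewrite mulr_sumr; apply: eq_bigr => i _; rewrite !mxE mulrA. Qed.

Lemma dotNl x y : dot (- x) y = - dot x y.
Proof. by rewrite -scaleN1r dotZl mulN1r. Qed.

Lemma dotBl x y z : dot (x - y) z = dot x z - dot y z.
Proof. by rewrite dotDl dotNl. Qed.

Lemma dotDr x y z : dot z (x + y) = dot z x + dot z y.
Proof. by rewrite dotC dotDl !(dotC z). Qed.

Lemma dotZr a x y : dot x (a *: y) = a * dot x y.
Proof. by rewrite dotC dotZl (dotC y). Qed.

Lemma dotNr x y : dot x (- y) = - dot x y.
Proof. by rewrite dotC dotNl (dotC y). Qed.

Lemma dotBr x y z : dot z (x - y) = dot z x - dot z y.
Proof. by rewrite dotDr dotNr. Qed.

Definition dotE := (dotDl, dotBl, dotZl, dotNl, dotDr, dotBr, dotZr, dotNr).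

Lemma dot_ge0 x : 0 <= dot x x.
Proof. by apply: sumr_ge0 => i _; rewrite -expr2 sqr_ge0. Qed.

Lemma enorm_sqr x : enorm x ^+ 2 = dot x x.
Proof.
rewrite /enorm sqr_sqrtr; first by apply: eq_bigr => i _; rewrite expr2.
by apply: sumr_ge0 => i _; rewrite sqr_ge0.
Qed.

Lemma enorm_ge0 x : 0 <= enorm x.
Proof. exact: sqrtr_ge0. Qed.

Lemma enorm_le x a : 0 <= a -> dot x x <= a ^+ 2 -> enorm x <= a.
Proof. by move=> a0; rewrite -enorm_sqr ler_pXn2r// nnegrE enorm_ge0. Qed.

Lemma enorm_eq0 x : enorm x = 0 -> x = 0.
Proof.
move=> x0; have := enorm_sqr x; rewrite x0 expr0n /= => /esym dx.
apply/rowP => i; rewrite mxE; apply/eqP; rewrite -sqrf_eq0 expr2.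
move/eqP: dx; rewrite psumr_eq0; first by move=> /allP/(_ i); rewrite mem_index_enum; exact.
by move=> j _; rewrite -expr2 sqr_ge0.
Qed.

Lemma enorm0 : enorm (0 : 'rV[R]_n) = 0.
Proof. by apply/eqP; rewrite -sqrf_eq0 enorm_sqr -(scale0r 0) dotZl mul0r. Qed.

Lemma enormZ a x : enorm (a *: x) = `|a| * enorm x.
Proof.
apply/eqP; rewrite -(@eqrXn2 _ 2)// ?mulr_ge0 ?enorm_ge0//.
by rewrite exprMn !enorm_sqr real_normK ?num_real// dotZl dotZr mulrA -expr2.
Qed.

Lemma enormN x : enorm (- x) = enorm x.
Proof. by rewrite -scaleN1r enormZ normrN1 mul1r. Qed.

Lemma enormB x y : enorm (x - y) = enorm (y - x).
Proof. by rewrite -enormN opprB. Qed.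

Lemma dot_le x y : dot x y <= enorm x * enorm y.
Proof.
have [/eqP|x0] := eqVneq (enorm x) 0.
  move=> /eqP x0; rewrite x0 mul0r (enorm_eq0 x0).
  by rewrite -(scale0r 0) dotZl mul0r.
have [/eqP|y0] := eqVneq (enorm y) 0.
  move=> /eqP y0; rewrite y0 mulr0 (enorm_eq0 y0).
  by rewrite -(scale0r 0) dotZr mul0r.
have px : 0 < enorm x by rewrite lt_neqAle eq_sym x0 enorm_ge0.
have py : 0 < enorm y by rewrite lt_neqAle eq_sym y0 enorm_ge0.
have := dot_ge0 (enorm y *: x - enorm x *: y).
rewrite !dotE -!enorm_sqr (dotC y x) => h.
have {}h : 0 <= 2 * (enorm x * enorm y) * (enorm x * enorm y - dot x y) by lra.
by rewrite -subr_ge0; move: h; rewrite pmulr_rge0// !mulr_gt0.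
Qed.

Lemma dot_norm_le x y : `|dot x y| <= enorm x * enorm y.
Proof. by rewrite ler_norml dot_le andbT lerNl -dotNl -(enormN x) dot_le. Qed.

Lemma enormD x y : enorm (x + y) <= enorm x + enorm y.
Proof.
apply: enorm_le; first by rewrite addr_ge0 ?enorm_ge0.
rewrite !dotE -!enorm_sqr (dotC y x) sqrrD.
have := dot_le x y; lra.
Qed.

Lemma enorm_triangle y x z : enorm (x - z) <= enorm (x - y) + enorm (y - z).
Proof. by have := enormD (x - y) (y - z); rewrite addrA subrK. Qed.

Lemma enorm_dist x y : `|enorm x - enorm y| <= enorm (x - y).
Proof.
rewrite ler_norml; apply/andP; split.
  by have := enormD (y - x) x; rewrite subrK enormB; lra.
by have := enormD (x - y) y; rewrite subrK; lra.
Qed.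

Lemma coord_le_enorm x i : `|x ord0 i| <= enorm x.
Proof.
rewrite -sqrtr_sqr ler_wsqrtr// (bigD1 i)//= lerDl.
by apply: sumr_ge0 => j _; rewrite sqr_ge0.
Qed.

Lemma norm_le_enorm x : `|x| <= enorm x.
Proof.
rewrite [leLHS]/Num.norm/= mx_normrE; apply/bigmax_leP; split; first exact: enorm_ge0.
by move=> [i j] _ /=; rewrite (ord1 i); exact: coord_le_enorm.
Qed.

Lemma coord_le_norm x i : `|x ord0 i| <= `|x|.
Proof.
rewrite [leRHS]/Num.norm/= mx_normrE.
exact: (le_bigmax _ (fun ij : 'I_1 * 'I_n => `|x ij.1 ij.2|) (ord0, i)).
Qed.

Lemma enorm_le_norm x : enorm x <= n%:R * `|x|.
Proof.
apply: enorm_le; first by rewrite mulr_ge0.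
apply: (@le_trans _ _ (\sum_(i < n) `|x| ^+ 2)).
  apply: ler_sum => i _; rewrite -expr2 -real_normK ?num_real//.
  by rewrite ler_pXn2r ?nnegrE// coord_le_norm.
rewrite sumr_const card_ord -[leLHS]mulr_natl exprMn ler_wpM2r ?sqr_ge0//.
by rewrite expr2 -natrM ler_nat; case: (n) => // m; rewrite leq_pmulr.
Qed.

(** The topology of ['rV[R]_n] comes from the sup norm; neighborhoods are
    described here by Euclidean balls, the only ones that occur below. *)
Lemma nbhs_enormP x (P : set 'rV[R]_n) :
  nbhs x P <-> exists2 e : R, 0 < e & forall y, enorm (y - x) < e -> P y.
Proof.
rewrite -nbhs_ballE; split=> [[e /= e0 xP]|[e e0 xP]].
  exists e => // y yx; apply: xP; rewrite mx_norm_ball /ball_ /=.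
  by rewrite -normrN opprB (le_lt_trans (norm_le_enorm _)).
have n1 : 0 < n%:R + 1 :> R by rewrite ltr_wpDl.
exists (e / (n%:R + 1)) => /=; first by rewrite divr_gt0.
move=> y; rewrite mx_norm_ball /ball_ /= => xy; apply: xP; rewrite enormB.
apply: (le_lt_trans (enorm_le_norm _)).
apply: (@le_lt_trans _ _ ((n%:R + 1) * `|x - y|)); first by rewrite ler_wpM2r// lerDl.
by rewrite mulrC -ltr_pdivlMr.
Qed.

(** Stewart's identity for the point dividing the segment from [x] to [y] at
    the fraction [a]: bounds on the distances from [z] to both ends give a bound
    on its distance to the chord. *)
Lemma stewart a x y z :
  enorm (z - (x + a *: (y - x))) ^+ 2 =
  (1 - a) * enorm (z - x) ^+ 2 + a * enorm (y - z) ^+ 2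
  - a * (1 - a) * enorm (y - x) ^+ 2.
Proof.
rewrite -(enormB z y) (_ : z - (x + a *: (y - x)) = (z - x) - a *: (y - x)); last by rewrite opprD addrA.
rewrite (_ : z - y = (z - x) - (y - x)); last by rewrite opprB addrA subrK.
by rewrite !enorm_sqr; move: (z - x) (y - x) => p q; rewrite !dotE (dotC q p); ring.
Qed.

End euclidean.

(** * Derivatives, and a mean value inequality for Lipschitz functions *)

Section derivatives.
Set Implicit Arguments.
Unset Strict Implicit.
Context {R : realType}.

(** Derivatives of a curve through error estimates, which convert directly
    into the inequalities used for lengths. *)
Lemma is_derive_err {V : normedModType R} (f : R -> V) (t : R) (v : V) :
  is_derive t (1 : R) f v <->
  forall e : R, 0 < e -> exists2 r : R, 0 < r &
    forall s, `|s - t| < r -> `|f s - f t - (s - t) *: v| <= e * `|s - t|.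
Proof.
have shiftE : (fun h : R => h^-1 *: (f (h *: (1 : R) + t) - f t)) =
    (fun h => h^-1 *: (f (h + t) - f t)).
  by apply/funext => h; rewrite /GRing.scale /= mulr1.
have E : is_derive t (1 : R) f v <->
    (fun h : R => h^-1 *: (f (h + t) - f t)) @ 0^' --> v.
  rewrite -shiftE; split => [[dd <-]|cv]; first exact: dd.
  by apply: DeriveDef; [apply/cvg_ex; exists v|exact: cvg_lim].
have errE s : s != t -> (s - t)^-1 *: (f s - f t - (s - t) *: v)
    = (s - t)^-1 *: (f s - f t) - v.
  by move=> st; rewrite scalerBr scalerA mulVf ?scale1r// subr_eq0.
rewrite E; split => [/cvgrPdist_le H e e0|H].
  have := H _ e0; rewrite near_withinE => /nbhs_ballP[r /= r0 rH].
  exists r => // s sr; have [->|st] := eqVneq s t.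
    by rewrite !subrr scale0r subrr !normr0 mulr0.
  have := rH (s - t); rewrite /ball /= sub0r normrN sr subr_eq0 => /(_ isT st).
  rewrite subrK -normrN opprB -errE// normrZ normfV.
  by rewrite ler_pdivrMl ?normr_gt0 ?subr_eq0// mulrC.
apply/cvgrPdist_le => e e0; have [r r0 rH] := H _ e0.
rewrite near_withinE; apply/nbhs_ballP; exists r => // h; rewrite /ball /= sub0r normrN => hr h0.
have := rH (h + t); rewrite addrK => /(_ hr).
have := errE (h + t); rewrite addrK -subr_eq0 addrK => /(_ h0) h1.
by move=> h2; rewrite -normrN opprB -h1 normrZ normfV ler_pdivrMl ?normr_gt0// mulrC.
Qed.

Lemma is_derive_eerr {n} (f : R -> 'rV[R]_n) (t : R) (v : 'rV[R]_n) :
  is_derive t (1 : R) f v <->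
  forall e : R, 0 < e -> exists2 r : R, 0 < r &
    forall s, `|s - t| < r -> enorm (f s - f t - (s - t) *: v) <= e * `|s - t|.
Proof.
rewrite is_derive_err; split => H e e0.
  have n1 : 0 < n%:R + 1 :> R by rewrite ltr_wpDl.
  have [|r r0 rH] := H (e / (n%:R + 1)); first by rewrite divr_gt0.
  exists r => // s /rH h; apply: (le_trans (enorm_le_norm _)).
  apply: (@le_trans _ _ ((n%:R + 1) * `|f s - f t - (s - t) *: v|)).
    by rewrite ler_wpM2r// lerDl.
  rewrite -ler_pdivlMl// (le_trans h)//; lra.
have [r r0 rH] := H _ e0.
by exists r => // s /rH; apply: le_trans; exact: norm_le_enorm.
Qed.

Lemma is_derive_dot {n} (f : R -> 'rV[R]_n) (t : R) (v w : 'rV[R]_n) :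
  is_derive t (1 : R) f v ->
  is_derive t (1 : R) (fun s => dot w (f s)) (dot w v).
Proof.
move=> /is_derive_eerr H; apply/is_derive_err => e e0.
have w1 : 0 < enorm w + 1 by rewrite ltr_wpDl ?enorm_ge0.
have [|r r0 rH] := H (e / (enorm w + 1)); first by rewrite divr_gt0.
exists r => // s /rH h.
rewrite {1}/GRing.scale /= -dotZr -!dotBr (le_trans (dot_norm_le _ _))//.
apply: (@le_trans _ _ ((enorm w + 1) * enorm (f s - f t - (s - t) *: v))).
  by rewrite ler_wpM2r ?enorm_ge0// lerDl.
rewrite -ler_pdivlMl// (le_trans h)//; lra.
Qed.

Lemma is_derive_scale {V : normedModType R} (l : R -> R) (t dl : R) (w : V) :
  is_derive t (1 : R) l dl -> is_derive t (1 : R) (fun s => l s *: w) (dl *: w).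
Proof.
move=> /is_derive_err H; apply/is_derive_err => e e0.
have w1 : 0 < `|w| + 1 by rewrite ltr_wpDl.
have [|r r0 rH] := H (e / (`|w| + 1)); first by rewrite divr_gt0.
exists r => // s /rH h.
rewrite scalerA -!scalerBl normrZ.
apply: (@le_trans _ _ (`|l s - l t - (s - t) * dl| * (`|w| + 1))).
  by rewrite ler_wpM2l// lerDl.
by rewrite -ler_pdivlMr// (le_trans h)// mulrAC.
Qed.

End derivatives.

Section lipschitz_ae.
Set Implicit Arguments.
Unset Strict Implicit.
Context {R : realType}.
Let mu := @lebesgue_measure R.

Lemma null_open_cover (N : set R) (e : R) : mu.-negligible N -> 0 < e ->
  exists U : set R, [/\ open U, N `<=` U & (mu U <= e%:E)%E].
Proof.
move=> [B [mB B0 NB]] e0.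
have Bfin : (mu B < +oo)%E by rewrite B0 ltry.
have [U [oU BU UB]] := lebesgue_regularity_outer mB Bfin e0.
exists U; split => //; first exact: subset_trans NB BU.
have mU : measurable U by exact: open_measurable.
have -> : U = (U `\` B) `|` B by rewrite setUC setDUK.
apply: (le_trans (measureU2 _ _ _)) => //; first exact: measurableD.
by rewrite [X in (_ + X)%E](_ : _ = 0%E) ?adde0 ?ltW.
Qed.

(** The exceptional null set is covered by an open set [U] of small measure, and
    [m x] is the measure of the part of [U] below [x].  The bound
    [H x <= H a + M * m x + e * (x - a)] propagates to the right of every point:
    outside [U] because the derivative exists and is nonpositive, inside [U]
    because there [m] grows at unit rate and pays for the Lipschitz bound.  The
    supremum of the points up to which it holds is therefore [b]. *)
Lemma lipschitz_ae_nonincreasing (H : R -> R) (M a b : R) : a <= b -> 0 <= M ->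
  (forall x y, a <= x <= b -> a <= y <= b -> `|H x - H y| <= M * `|x - y|) ->
  {ae mu, forall x, a < x < b -> exists2 h, is_derive x (1 : R) H h & h <= 0} ->
  H b <= H a.
Proof.
move=> ab M0 Hlip Hae.
suff key e : 0 < e -> H b <= H a + e * (M + (b - a)).
  apply/ler_addgt0Pr => e e0.
  have c0 : 0 < M + (b - a) + 1 by rewrite ltr_wpDl// addr_ge0// subr_ge0.
  have := key (e / (M + (b - a) + 1)); rewrite divr_gt0// => /(_ isT) /le_trans; apply.
  rewrite lerD2l mulrAC ler_pdivrMr// ler_pM2l//; lra.
move=> e0.
(* Nothing is known about the derivative at [a]: this point is put into [U] too. *)
have [U [oU NU Ue]] : exists U : set R, [/\ open U,
    (~` [set x | a < x < b -> exists2 h, is_derive x (1 : R) H h & h <= 0] `|` [set a]) `<=` U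
    & (mu U <= e%:E)%E].
  apply: null_open_cover => //; apply: negligibleU => //.
  by exists [set a]; split => //; exact: lebesgue_measure_set1.
have mU : measurable U by exact: open_measurable.
pose m x := fine (mu (U `&` `]a, x])).
have mfin x : mu (U `&` `]a, x]) \is a fin_num.
  rewrite ge0_fin_numE//; apply: (le_lt_trans _ (ltry e)); apply: le_trans Ue.
  by apply: le_measure; rewrite ?inE//; exact: measurableI.
have mE x : (m x)%:E = mu (U `&` `]a, x]) by rewrite fineK.
have me x : m x <= e.
  rewrite -lee_fin mE; apply: le_trans Ue.
  by apply: le_measure; rewrite ?inE//; exact: measurableI.
have m_incr x y : x <= y -> m x <= m y.
  move=> xy; rewrite -lee_fin !mE; apply: le_measure; rewrite ?inE//; do 1?exact: measurableI.
  apply: setIS => z /=; rewrite !in_itv /= => /andP[-> /le_trans]; exact.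
have m_add x y : a <= x -> x <= y -> `]x, y] `<=` U -> m x + (y - x) <= m y.
  move=> ax xy xyU; rewrite -lee_fin EFinD !mE.
  have <- : mu `]x, y] = (y - x)%:E.
    rewrite /mu lebesgue_measure_itv /= lte_fin; by case: (ltgtP x y) xy => [_ _|//|->]; rewrite ?subrr.
  rewrite -measureU//; do ?exact: measurableI.
    apply: le_measure; rewrite ?inE//; do ?[exact: measurableI|exact: measurableU|apply: measurableU => //].
    move=> z /= [[Uz]|zxy]; rewrite !in_itv /=.
      by move=> /andP[-> /le_trans ->].
    split; first exact: xyU.
    by move: zxy; rewrite /= !in_itv /= => /andP[/(le_lt_trans ax) -> ->].
  apply/seteqP; split => // z /= [[_]]; rewrite !in_itv /= => /andP[_ zx] /andP[xz _].
  by move: (lt_le_trans xz zx); rewrite ltxx.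
pose P := [set x | a <= x <= b /\ H x <= H a + M * m x + e * (x - a)].
have Pa : P a.
  split; first by rewrite lexx ab.
  rewrite subrr mulr0 addr0 lerDl mulr_ge0//.
  exact: fine_ge0.
have Psup : has_sup P by split; [exists a | exists b => x [/andP[]]].
have sP : P (sup P).
  have sab : a <= sup P <= b.
    apply/andP; split; first by apply: ub_le_sup => //; case: Psup.
    by apply: ge_sup => [|x [/andP[]]//]; exists a.
  split => //; apply/ler_addgt0Pr => d d0.
  have d1 : 0 < d / (M + 1) by rewrite divr_gt0// ltr_wpDl.
  have [x [xab Px] xs] := sup_adherent d1 Psup.
  have xs' : x <= sup P by apply: ub_le_sup; [case: Psup|].
  have := Hlip _ _ sab xab; rewrite ler_norml => /andP[_].
  rewrite ger0_norm ?subr_ge0// => h1.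
  have h2 : M * (sup P - x) <= d.
    apply: (@le_trans _ _ ((M + 1) * (d / (M + 1)))).
      by apply: ler_pM; rewrite ?subr_ge0// ?lerDl//; lra.
    by rewrite mulrC divfK// gt_eqF// ltr_wpDl.
  have h3 := m_incr _ _ xs'.
  have h4 : M * m x <= M * m (sup P) by rewrite ler_wpM2l.
  have h5 : e * (x - a) <= e * (sup P - a) by rewrite ler_pM2l// lerD2r.
  lra.
have [sab sH] := sP.
have /orP[/eqP sb|sb] : (sup P == b) || (sup P < b) by rewrite -le_eqVlt; case/andP: sab.
  by move: sH; rewrite sb => sH; have := ler_wpM2l M0 (me b); lra.
exfalso.
have as_ : a <= sup P by case/andP: sab.
suff [h h0 Ph] : exists2 h, 0 < h & P (sup P + h).
  have : sup P + h <= sup P by apply: ub_le_sup; [case: Psup|].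
  by rewrite gerDl leNgt h0.
have [sU|sU] := pselect (U (sup P)).
  have /nbhs_ballP[r /= r0 rU] : nbhs (sup P) U by exact: open_nbhs_nbhs.
  pose h := Num.min (r / 2) (b - sup P).
  have h0 : 0 < h by rewrite lt_min divr_gt0//= subr_gt0.
  have hb : h <= b - sup P by rewrite ge_min lexx orbT.
  have hr : h < r by apply: (@le_lt_trans _ _ (r / 2)); [rewrite ge_min lexx|lra].
  exists h => //; split; first by lra.
  have h1 : m (sup P) + h <= m (sup P + h).
    have := m_add (sup P) (sup P + h) as_; rewrite addrAC subrr add0r; apply.
      by rewrite lerDl ltW.
    move=> z /=; rewrite in_itv /= => /andP[z1 z2]; apply: rU.
    rewrite /ball /= ltr_norml; lra.
  have := Hlip (sup P + h) (sup P); rewrite addrAC subrr add0r (ger0_norm (ltW h0)).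
  move=> /(_ _ sab); rewrite ler_norml => h2.
  have {h2}/andP[_ h2] := h2 ltac:(lra).
  have h3 : M * (m (sup P) + h) <= M * m (sup P + h) by rewrite ler_wpM2l.
  have h4 : 0 <= e * h by rewrite mulr_ge0// ltW.
  lra.
have sa : a < sup P.
  rewrite lt_neqAle as_ andbT; apply/eqP => sa; apply: sU; apply: NU; right.
  by rewrite sa.
have [d dH d0] : exists2 h, is_derive (sup P) (1 : R) H h & h <= 0.
  have [//|nd] := pselect (exists2 h, is_derive (sup P) (1 : R) H h & h <= 0).
  by exfalso; apply: sU; apply: NU; left => /= /(_ _)/nd; apply; rewrite sa sb.
have /is_derive_err/(_ _ e0)[r r0 rU] := dH.
pose h := Num.min (r / 2) (b - sup P).
have h0 : 0 < h by rewrite lt_min divr_gt0//= subr_gt0.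
have hb : h <= b - sup P by rewrite ge_min lexx orbT.
have hr : h < r by apply: (@le_lt_trans _ _ (r / 2)); [rewrite ge_min lexx|lra].
exists h => //; split; first by lra.
have := rU (sup P + h); rewrite addrAC subrr add0r ger0_norm ?(ltW h0)// => /(_ hr).
rewrite ler_norml => /andP[_]; rewrite {1}[_ *: d]/GRing.scale /= => h1.
have h2 : h * d <= 0 by rewrite pmulr_rle0.
have h3 : M * m (sup P) <= M * m (sup P + h) by rewrite ler_wpM2l// m_incr// lerDl ltW.
lra.
Qed.

End lipschitz_ae.

(** * Bent chords above the graph of a function with Lipschitz gradient *)

Section bent_chords.
Set Implicit Arguments.
Unset Strict Implicit.
Context {R : realType} {d : nat}.
Implicit Types (K : set 'rV[R]_d) (x y p v w n : 'rV[R]_d).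

(** A parabola with end points [x] and [y].  As the correction [w] is orthogonal
    to the chord and quadratic in its length [h], the parabola is longer than the
    chord only by [O(h ^ 3)], uniformly along the parametrization. *)
Definition bent_chord K (C : R) x y := exists w,
  [/\ dot w (y - x) = 0, enorm w <= C * enorm (y - x) ^+ 2 &
      forall s : R, 0 <= s <= 1 -> K (x + s *: (y - x) + (s * (1 - s)) *: w)].

Lemma bent_chord_le K (C C' : R) x y : C <= C' -> bent_chord K C x y -> bent_chord K C' x y.
Proof.
move=> CC' [w [w1 w2 w3]]; exists w; split => //; apply: (le_trans w2).
by rewrite ler_wpM2r// sqr_ge0.
Qed.

Lemma convex_eball p (r : R) x y (s : R) : 0 <= s <= 1 ->
  enorm (x - p) < r -> enorm (y - p) < r -> enorm (x + s *: (y - x) - p) < r.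
Proof.
move=> /andP[s0 s1] xp yp.
have -> : x + s *: (y - x) - p = (1 - s) *: (x - p) + s *: (y - p).
  by apply/rowP => i; rewrite !mxE; ring.
apply: (le_lt_trans (enormD _ _)); rewrite !enormZ !ger0_norm ?subr_ge0//.
have [->|s10] := eqVneq s 1; first by rewrite subrr mul0r add0r mul1r.
have : 0 < 1 - s by rewrite subr_gt0 lt_neqAle s10.
move=> s2; have h1 : (1 - s) * enorm (x - p) < (1 - s) * r by rewrite ltr_pM2l.
have h2 : s * enorm (y - p) <= s * r by rewrite ler_wpM2l// ltW.
lra.
Qed.

Lemma straight_bent_chord K p (r C : R) x y : 0 <= C ->
  (forall z, enorm (z - p) < r -> K z) ->
  enorm (x - p) < r -> enorm (y - p) < r -> bent_chord K C x y.
Proof.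
move=> C0 Kr xp yp; exists 0; split.
- by rewrite -(scale0r 0) dotZl mul0r.
- by rewrite enorm0 mulr_ge0// sqr_ge0.
- by move=> s s01; rewrite scaler0 addr0; apply: Kr; exact: convex_eball.
Qed.

Lemma mvt_cc (f df : R -> R) (a b : R) : a <= b ->
  (forall t : R, a <= t <= b -> is_derive t (1 : R) f (df t)) ->
  exists2 c, a <= c <= b & f b - f a = df c * (b - a).
Proof.
move=> ab H; have [||c] := @MVT_segment R f df a b ab.
- by move=> t; rewrite in_itv /= => /andP[/ltW ? /ltW ?]; apply: H; apply/andP.
- apply: continuous_in_subspaceT => t; rewrite inE /= in_itv /= => /H[+ _].
  by move=> /derivable1_diffP; exact: differentiable_continuous.
- by rewrite in_itv /= => ? ?; exists c.
Qed.

(** A function that is nonnegative at both ends of the unit interval stays above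
    minus a multiple of the parabola [t * (1 - t)]: write [F t] as a convex
    combination of [F 0] and [F 1] plus [t * (1 - t)] times a difference of two
    values of the derivative. *)
Lemma chord_defect (F dF : R -> R) (M : R) :
  (forall t : R, 0 <= t <= 1 -> is_derive t (1 : R) F (dF t)) ->
  (forall s t : R, 0 <= s <= 1 -> 0 <= t <= 1 -> `|dF s - dF t| <= M) ->
  0 <= F 0 -> 0 <= F 1 ->
  forall t : R, 0 <= t <= 1 -> - (M * (t * (1 - t))) <= F t.
Proof.
move=> HF HdF F0 F1 t /andP[t0 t1].
have [|c /andP[c0 ct] E0] := @mvt_cc F dF 0 t t0.
  by move=> s /andP[s0 st]; apply: HF; lra.
have [|c' /andP[c0' ct'] E1] := @mvt_cc F dF t 1 t1.
  by move=> s /andP[s0 st]; apply: HF; lra.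
have := HdF c c'; rewrite ler_norml => /(_ ltac:(lra) ltac:(lra))/andP[h _].
have k : 0 <= t * (1 - t) by rewrite mulr_ge0// subr_ge0.
have -> : F t = (1 - t) * F 0 + t * F 1 + (t * (1 - t)) * (dF c - dF c').
  have -> : F 0 = F t - dF c * t by lra.
  have -> : F 1 = F t + dF c' * (1 - t) by lra.
  ring.
have h1 : (t * (1 - t)) * - M <= (t * (1 - t)) * (dF c - dF c') by rewrite ler_wpM2l.
have h2 : 0 <= (1 - t) * F 0 by rewrite mulr_ge0// subr_ge0.
have h3 : 0 <= t * F 1 by rewrite mulr_ge0.
lra.
Qed.

(** Where [phi] has Lipschitz gradient, it can become negative on a chord of
    length [h] only by [M * h ^ 2 * (s * (1 - s))].  Moving the chord by a multiple
    of [h ^ 2 * (s * (1 - s))] in the direction [n], along which [phi] increases at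
    least at the rate [kappa], compensates this.  The component of that
    displacement along the chord is absorbed into a reparametrization [psi] of the
    chord, so that only the orthogonal component remains as a correction. *)
Lemma pushed_chord K (phi : 'rV[R]_d -> R) (dphi : 'rV[R]_d -> 'rV[R]_d -> R)
    p n (r M kappa : R) :
  0 < r -> 0 <= M -> 0 < kappa -> enorm n <= 1 ->
  (forall x v (t : R), enorm (x + t *: v - p) < r ->
     is_derive t (1 : R) (fun s => phi (x + s *: v)) (dphi (x + t *: v) v)) ->
  (forall x y v, enorm (x - p) < r -> enorm (y - p) < r ->
     `|dphi x v - dphi y v| <= M * enorm (x - y) * enorm v) ->
  (forall x, enorm (x - p) < r -> kappa <= dphi x n) ->
  (forall x, enorm (x - p) < r -> 0 <= phi x -> K x) ->
  exists C r' : R, [/\ 0 <= C, 0 < r' &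
    forall x y, enorm (x - p) < r' -> enorm (y - p) < r' ->
      0 <= phi x -> 0 <= phi y -> bent_chord K C x y].
Proof.
move=> r0 M0 k0 n1 Hphi Hlip Hk HK.
(* With [m * h <= 1 / 2], [psi * (1 - psi)] is at most [9 / 4] times
   [s * (1 - s)]; [m] makes the gain [kappa * m] equal to that multiple of [M]. *)
pose m := 9 / 4 * M / kappa.
have m0 : 0 <= m by rewrite divr_ge0 ?(ltW k0)// mulr_ge0.
have m1 : 0 < 4 * (m + 1) by lra.
pose r' := Num.min (r / 2) (4 * (m + 1))^-1.
have r'0 : 0 < r' by rewrite lt_min invr_gt0 m1 andbT; lra.
have r'r : r' <= r / 2 by rewrite ge_min lexx.
have r'm : r' * (4 * (m + 1)) <= 1.
  by rewrite -ler_pdivlMr// mul1r ge_min lexx orbT.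
exists (2 * m), r'; split => //; first by rewrite mulr_ge0.
move=> x y xp yp phix phiy.
set e := y - x; set h := enorm e.
have h0 : 0 <= h by exact: enorm_ge0.
have hr' : h < 2 * r'.
  by have := enorm_triangle p y x; rewrite (enormB p x) -/e -/h; lra.
have mh : m * h <= 1 / 2.
  have : m * h <= m * (2 * r') by rewrite ler_wpM2l// ltW.
  lra.
set b := m * dot n e.
have bh : `|b| <= m * h.
  rewrite normrM (ger0_norm m0) ler_wpM2l// (le_trans (dot_norm_le _ _))//.
  by rewrite -[leRHS]mul1r ler_wpM2r ?enorm_ge0.
have /andP[b1 b2] : - (1 / 2) <= b <= 1 / 2 by rewrite -ler_norml (le_trans bh).
have mh2 : 0 <= m * h ^+ 2 by rewrite mulr_ge0// sqr_ge0.
exists ((m * h ^+ 2) *: n - b *: e); split.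
- by rewrite dotBl !dotZl -enorm_sqr -/e -/h /b; ring.
- apply: (le_trans (enormD _ _)); rewrite enormN !enormZ -/h.
  have h1 : `|m * h ^+ 2| * enorm n <= m * h ^+ 2.
    by rewrite ger0_norm// ler_piMr.
  have h2 : `|b| * h <= m * h * h by rewrite ler_wpM2r.
  by lra.
move=> s s01; have /andP[s0 s1] := s01.
have k1 : 0 <= s * (1 - s) by rewrite mulr_ge0// subr_ge0.
have nb : `|b| <= 1 / 2 by rewrite ler_norml b1.
have ns : `|s| <= 1 by rewrite ger0_norm.
have ns1 : `|1 - s| <= 1 by rewrite ger0_norm ?subr_ge0// gerBl.
pose psi := s - s * (1 - s) * b.
have psi01 : 0 <= psi <= 1.
  have -> : psi = s * (1 - (1 - s) * b) by rewrite /psi; ring.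
  have h1 : `|(1 - s) * b| <= 1 / 2.
    by rewrite normrM -[leRHS]mul1r ler_pM.
  move: h1; rewrite ler_norml => /andP[h1 h2]; apply/andP; split.
    by rewrite mulr_ge0//; lra.
  rewrite -subr_ge0.
  have -> : 1 - s * (1 - (1 - s) * b) = (1 - s) * (1 + s * b) by ring.
  have h3 : `|s * b| <= 1 / 2.
    by rewrite normrM -[leRHS]mul1r ler_pM.
  by move: h3; rewrite ler_norml => /andP[? ?]; rewrite mulr_ge0//; lra.
have psi2 : psi * (1 - psi) <= 9 / 4 * (s * (1 - s)).
  have -> : psi * (1 - psi) = (s * (1 - s)) * ((1 - (1 - s) * b) * (1 + s * b)).
    by rewrite /psi; ring.
  rewrite [leRHS]mulrC ler_wpM2l//.
  have h3 : `|s * b| <= 1 / 2.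
    by rewrite normrM -[leRHS]mul1r ler_pM.
  have h1 : `|(1 - s) * b| <= 1 / 2.
    by rewrite normrM -[leRHS]mul1r ler_pM.
  move: h1 h3; rewrite !ler_norml => /andP[? ?] /andP[? ?].
  have -> : 9 / 4 = (3 / 2) * (3 / 2) :> R by lra.
  by apply: ler_pM; rewrite ?subr_ge0; lra.
have -> : x + s *: e + (s * (1 - s)) *: ((m * h ^+ 2) *: n - b *: e) =
    x + psi *: e + (m * h ^+ 2 * (s * (1 - s))) *: n.
  by rewrite /psi; apply/rowP => i; rewrite !mxE; ring.
set c := x + psi *: e; set tau := m * h ^+ 2 * (s * (1 - s)).
have tau0 : 0 <= tau by exact: mulr_ge0.
have tauh : tau <= r'.
  have q : s * (1 - s) <= 1 by rewrite mulr_ile1// ?subr_ge0// gerBl.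
  have q1 : tau <= m * h ^+ 2 by rewrite ler_piMr.
  have q2 : m * h ^+ 2 <= 1 / 2 * h by rewrite expr2 mulrA ler_wpM2r.
  lra.
have cp : enorm (c - p) < r' by exact: convex_eball.
have inB t : 0 <= t <= tau -> enorm (c + t *: n - p) < r.
  move=> /andP[t0 tt]; rewrite addrAC (le_lt_trans (enormD _ _))// enormZ ger0_norm//.
  have : t * enorm n <= t * 1 by rewrite ler_wpM2l.
  lra.
have phic : - (M * h ^+ 2 * (psi * (1 - psi))) <= phi c.
  apply: (@chord_defect (fun s => phi (x + s *: e)) (fun t => dphi (x + t *: e) e)) => //.
  - move=> t t01; apply: Hphi; apply: (@lt_le_trans _ _ r'); last lra.
    exact: convex_eball.
  - move=> s' t' s'01 t'01.
    apply: (le_trans (Hlip _ _ _ _ _)).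
    + by apply: (@lt_le_trans _ _ r'); [exact: convex_eball|lra].
    + by apply: (@lt_le_trans _ _ r'); [exact: convex_eball|lra].
    rewrite -/h expr2 mulrA ler_wpM2r// ler_wpM2l//.
    have -> : x + s' *: e - (x + t' *: e) = (s' - t') *: e.
      by apply/rowP => i; rewrite !mxE; ring.
    rewrite enormZ -/h -[leRHS]mul1r ler_wpM2r// ler_norml; lra.
  - by rewrite scale0r addr0.
  - by rewrite scale1r /e addrC subrK.
have tau' : 0 <= tau <= tau by rewrite tau0 lexx.
apply: HK; first exact: inB.
have [|z zt E] := @mvt_cc (fun s => phi (c + s *: n)) (fun t => dphi (c + t *: n) n) 0 tau tau0.
  by move=> t tt; apply: Hphi; exact: inB.
move: E; rewrite scale0r addr0 subr0 => E.
have kz : kappa * tau <= dphi (c + z *: n) n * tau by rewrite ler_wpM2r// Hk// inB.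
have kt : kappa * tau = M * h ^+ 2 * (9 / 4 * (s * (1 - s))).
  rewrite /tau /m; have := lt0r_neq0 k0 => kn.
  by field.
have h3 : M * h ^+ 2 * (psi * (1 - psi)) <= M * h ^+ 2 * (9 / 4 * (s * (1 - s))).
  by rewrite ler_wpM2l// mulr_ge0// sqr_ge0.
lra.
Qed.

End bent_chords.

(** * Bent chords in a domain with boundary of class C^{1,1} *)

Section domain_geometry.
Set Implicit Arguments.
Unset Strict Implicit.
Context {R : realType} {d : nat}.
Implicit Types (x y p v w n : 'rV[R]_d).

Lemma is_derive_line {m} (f : 'rV[R]_d -> 'rV[R]_m) x v (t : R) :
  differentiable f (x + t *: v) ->
  is_derive t (1 : R) (fun s => f (x + s *: v)) ('d f (x + t *: v) v).
Proof.
move=> df; have dv : derivable f (x + t *: v) v by exact: diff_derivable.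
have E : (fun h : R => h^-1 *: (f (x + (h *: (1 : R) + t) *: v) - f (x + t *: v)))
       = (fun h : R => h^-1 *: (f (h *: v + (x + t *: v)) - f (x + t *: v))).
  apply/funext => h; congr (_ *: (f _ - _)).
  by rewrite /GRing.scale /= mulr1 -/(_ *: _) scalerDl addrCA.
apply: DeriveDef; first by move: dv; rewrite /derivable /= -E.
rewrite -(deriveE v df).
rewrite /derive /=.
by rewrite -E.
Qed.

Lemma C11_on_ge0 {m} (U : set 'rV[R]_d) (f : 'rV[R]_d -> 'rV[R]_m) : C11_on U f ->
  exists2 M : R, 0 <= M & forall x y, U x -> U y -> forall v,
    enorm ('d f x v - 'd f y v) <= M * enorm (x - y) * enorm v.
Proof.
move=> [_ [M HM]]; exists `|M| => // x y Ux Uy v; apply: (le_trans (HM _ _ Ux Uy v)).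
by rewrite ler_wpM2r ?enorm_ge0// ler_wpM2r ?enorm_ge0// ler_norm.
Qed.

Lemma dot_delta x (i : 'I_d) : dot (delta_mx ord0 i) x = x ord0 i.
Proof.
rewrite /dot (bigD1 i)//= mxE !eqxx mul1r big1 ?addr0// => j ji.
by rewrite mxE eqxx (negbTE ji) mul0r.
Qed.

Variables (Omega : set 'rV[R]_d).
Hypothesis Omega_open : open Omega.
Let K := closure Omega.

Lemma frontierE x : frontier Omega x <-> K x /\ ~ Omega x.
Proof. by rewrite /frontier ((interior_id Omega).1 Omega_open). Qed.

Lemma local_bent_chord_interior p : Omega p ->
  exists C r : R, [/\ 0 <= C, 0 < r &
    forall x y, enorm (x - p) < r -> enorm (y - p) < r -> bent_chord K C x y].
Proof.
move=> Op; have /nbhs_enormP[r r0 rO] : nbhs p Omega by exact: open_nbhs_nbhs.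
exists 0, r; split => // x y; apply: straight_bent_chord => // z zp.
by apply: subset_closure; exact: rO.
Qed.

(** In a connected set avoiding the boundary, the trace of [Omega] is open, and
    closed because it is also the trace of the closure. *)
Lemma connected_in_open (E : set 'rV[R]_d) : connected E -> E `&` frontier Omega = set0 ->
  E `&` Omega !=set0 -> E `<=` Omega.
Proof.
move=> cE E0 EO; have <- : E `&` Omega = E; last by move=> x [].
apply: cE => //; first by exists Omega.
exists K; first exact: closed_closure.
apply/seteqP; split => [x [Ex Ox]|x [Ex Kx]]; first by split => //; exact: subset_closure.
split => //; apply: contrapT => nO.
have : (E `&` frontier Omega) x by split => //; apply/frontierE.
by rewrite E0.
Qed.

Section chart.
Variables (p : 'rV[R]_d) (U V : set 'rV[R]_d) (f g : 'rV[R]_d -> 'rV[R]_d) (i0 : 'I_d).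
Hypotheses (oU : open U) (Up : U p) (oV : open V) (fg : C11_diffeo U V f g).
Hypothesis front : forall x, U x -> (frontier Omega x <-> f x ord0 i0 = 0).
Hypothesis Fp : frontier Omega p.

Let phi x : R := f x ord0 i0.
Let dphi x v : R := ('d f x v : 'rV[R]_d) ord0 i0.

Lemma chart_neighborhood : exists rho : R, [/\ 0 < rho,
  (forall y, enorm (y - f p) < rho -> V y) &
  exists2 r : R, 0 < r & forall x, enorm (x - p) < r -> U x /\ enorm (f x - f p) < rho].
Proof.
have [[df _] _ UV _] := fg.
have /nbhs_enormP[rho rho0 Hrho] : nbhs (f p) V.
  by apply: open_nbhs_nbhs; split => //; case: (UV _ Up).
exists rho; split => //.
have fc : {for p, continuous f} by apply: differentiable_continuous; exact: df.
have N1 : nbhs p U by exact: open_nbhs_nbhs.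
have N2 : nbhs p (f @^-1` [set y | enorm (y - f p) < rho]).
  by apply: fc; apply/nbhs_enormP; exists rho.
have /nbhs_enormP[r1 r10 Hr1] := N1.
have /nbhs_enormP[r2 r20 Hr2] := N2.
exists (Num.min r1 r2) => [|x]; first by rewrite lt_min r10.
by rewrite lt_min => /andP[/Hr1 ? /Hr2].
Qed.

(** The chart turns the two sides of the boundary into convex half balls; the
    image of a segment of a half ball is connected and avoids the boundary. *)
Lemma one_side (rho : R) (sg : R) y1 y2 :
  (forall y, enorm (y - f p) < rho -> V y) ->
  enorm (y1 - f p) < rho -> enorm (y2 - f p) < rho ->
  0 < sg * y1 ord0 i0 -> 0 < sg * y2 ord0 i0 -> Omega (g y1) -> Omega (g y2).
Proof.
have [_ [dg _] _ VU] := fg.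
move=> HV y1p y2p y1s y2s O1.
pose seg (s : R) := y1 + s *: (y2 - y1).
have segV s : 0 <= s <= 1 -> V (seg s) by move=> s01; apply: HV; exact: convex_eball.
pose E := (g \o seg) @` `[0, 1].
have cE : connected E.
  apply: connected_continuous_connected; first exact: segment_connected.
  apply: continuous_in_subspaceT => s; rewrite inE /= in_itv /= => s01.
  apply: continuous_comp; last by apply: differentiable_continuous; apply: dg; exact: segV.
  by apply: cvgD; [exact: cvg_cst|apply: cvgZr_tmp; exact: cvg_id].
suff : E `<=` Omega.
  by apply; exists 1; rewrite /= ?in_itv /= ?lexx ?ler01// /seg scale1r addrC subrK.
apply: connected_in_open => //.
  apply/seteqP; split => // z [[s]]; rewrite /= in_itv /= => s01 <- Fz.
  have [Ug fgs] := VU _ (segV _ s01).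
  move: Fz => /(front Ug); rewrite fgs /seg !mxE => h.
  move: s01 => /andP[s0 s1].
  have h1 : 0 <= s * (sg * y2 ord0 i0) by rewrite mulr_ge0// ltW.
  have [s1'|s1'] := eqVneq s 1.
    by move: h; rewrite s1' mul1r addrC subrK => h; move: y2s; rewrite h mulr0 ltxx.
  have h2 : 0 < (1 - s) * (sg * y1 ord0 i0).
    by rewrite mulr_gt0// subr_gt0 lt_neqAle s1'.
  have h3 : sg * (y1 ord0 i0 + s * (y2 ord0 i0 - y1 ord0 i0)) = 0 by rewrite h mulr0.
  lra.
exists (g y1); split => //.
by exists 0; rewrite /= ?in_itv /= ?lexx ?ler01// /seg scale0r addr0.
Qed.

(** The direction in which the defining function increases is the preimage of a
    basis vector under ['d f p], which is onto because [f] has a differentiable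
    right inverse. *)
Lemma chart_normal : exists n (kappa : R), [/\ 0 < kappa, enorm n <= 1 & kappa <= dphi p n].
Proof.
have [[df _] [dg _] UV VU] := fg.
have [Vp gfp] := UV _ Up.
pose e : 'rV[R]_d := delta_mx ord0 i0.
pose n0 : 'rV[R]_d := 'd g (f p) e.
have dgp := dg _ Vp.
have dfp : differentiable f (g (f p)) by rewrite gfp; exact: df.
have E : 'd f p n0 = e :> 'rV[R]_d.
  have dc : 'd (f \o g) (f p) e = 'd f (g (f p)) ('d g (f p) e).
    exact: (congr1 (@^~ e) (diff_comp dgp dfp)).
  rewrite gfp in dc; rewrite /n0 -dc -(deriveE e (differentiable_comp dgp dfp)).
  rewrite -[RHS](derive_id (f p) e).
  apply: near_eq_derive; have : nbhs (f p) V by exact: open_nbhs_nbhs.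
  by apply: filterS => y /VU[_].
have n00 : 0 < enorm n0.
  rewrite lt_neqAle enorm_ge0 andbT eq_sym; apply/eqP => /enorm_eq0 n00.
  move: E; rewrite n00 linear0 => /rowP/(_ i0); rewrite !mxE !eqxx /= => /eqP.
  by rewrite eq_sym oner_eq0.
exists ((enorm n0)^-1 *: n0), (enorm n0)^-1; split; first by rewrite invr_gt0.
  by rewrite enormZ ger0_norm ?invr_ge0 ?enorm_ge0// mulVf// gt_eqF.
by rewrite /dphi linearZ /= E !mxE !eqxx mulr1.
Qed.

Lemma chart_pushed (sg : R) (r : R) : (sg = 1 \/ sg = -1) -> 0 < r ->
  (forall x, enorm (x - p) < r -> U x) ->
  (forall x, enorm (x - p) < r -> 0 <= sg * phi x -> K x) ->
  (forall x, enorm (x - p) < r -> K x -> 0 <= sg * phi x) ->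
  exists C r : R, [/\ 0 <= C, 0 < r &
    forall x y, enorm (x - p) < r -> enorm (y - p) < r -> K x -> K y -> bent_chord K C x y].
Proof.
move=> sgE r0 rU rK Kr.
have [fC _ _ _] := fg; have [df _] := fC.
have [M M0 HM] := C11_on_ge0 fC.
have [n [kap [kap0 n1 nk]]] := chart_normal.
have sg2 : sg * sg = 1 by case: sgE => ->; ring.
have sg1 : `|sg| = 1 by case: sgE => ->; rewrite ?normrN normr1.
pose r1 := Num.min r (kap / 2 / (M + 1)).
have r10 : 0 < r1 by rewrite lt_min r0 !divr_gt0// ltr_wpDl.
have r1r : r1 <= r by rewrite ge_min lexx.
have r1k : M * r1 <= kap / 2.
  apply: (@le_trans _ _ ((M + 1) * (kap / 2 / (M + 1)))).
    apply: ler_pM => //; rewrite ?(ltW r10)// ?lerDl//.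
    by rewrite /r1 ge_min lexx orbT.
  by rewrite mulrC divfK// gt_eqF// ltr_wpDl.
have inr z : enorm (z - p) < r1 -> enorm (z - p) < r by move/lt_le_trans; apply.
have inU z : enorm (z - p) < r1 -> U z by move/inr/rU.
have Hlip x y v : enorm (x - p) < r1 -> enorm (y - p) < r1 ->
    `|dphi x v - dphi y v| <= M * enorm (x - y) * enorm v.
  move=> /inU xU /inU yU; apply: le_trans (HM _ _ xU yU v).
  by have := coord_le_enorm ('d f x v - 'd f y v) i0; rewrite !mxE.
have [||||||||C [r' [C0 r'0 H]]] := @pushed_chord R d K (fun x => sg * phi x)
    (fun x v => sg * dphi x v) p (sg *: n) r1 M (kap / 2) => //.
- by rewrite divr_gt0.
- by rewrite enormZ sg1 mul1r.
- move=> x v t xt.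
  have := is_derive_line (df _ (inU _ xt)).
  move=> /(is_derive_dot (sg *: delta_mx ord0 i0)).
  rewrite dotZl dot_delta.
  by congr (is_derive _ _ _ _); apply/funext => s; rewrite dotZl dot_delta.
- by move=> x y v xp yp; rewrite -mulrBr normrM sg1 mul1r Hlip.
- move=> x xp; rewrite /dphi linearZ /= mxE mulrA sg2 mul1r -/(dphi x n).
  have pp : enorm (p - p) < r1 by rewrite subrr enorm0.
  have := Hlip _ _ n xp pp; rewrite ler_norml => /andP[h _].
  have h1 : M * enorm (x - p) * enorm n <= M * r1.
    rewrite -[leRHS]mulr1; apply: ler_pM => //; rewrite ?mulr_ge0 ?enorm_ge0//.
    by rewrite ler_wpM2l// ltW.
  by clear -h h1 nk r1k; move: (dphi x n) (dphi p n) h nk => a b h nk; lra.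
- by move=> x xp; apply: rK; exact: inr.
exists C, (Num.min r1 r'); split => //; first by rewrite lt_min r10.
move=> x y; rewrite 2!(lt_min _ r1) => /andP[/inr x1 x2] /andP[/inr y1 y2] Kx Ky.
by apply: H => //; exact: Kr.
Qed.

(** Each side of the boundary near [p] is either contained in [Omega] or disjoint
    from its closure.  If both are contained in [Omega], straight chords remain in
    the closure; otherwise exactly one is, and the closure is locally the set where
    [phi], or [- phi], is nonnegative. *)
Lemma chart_bent_chord : exists C r : R, [/\ 0 <= C, 0 < r &
  forall x y, enorm (x - p) < r -> enorm (y - p) < r -> K x -> K y -> bent_chord K C x y].
Proof.
have [rho [rho0 HV [r r0 Hr]]] := chart_neighborhood.
have [_ _ UV VU] := fg.
pose Ps (sg : R) := exists y, [/\ enorm (y - f p) < rho, 0 < sg * y ord0 i0 & Omega (g y)].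
have Ps_in sg x : sg != 0 -> Ps sg -> enorm (x - p) < r -> 0 <= sg * phi x -> K x.
  move=> sg0 [y [yp ys Oy]] /Hr[Ux xp]; rewrite le_eqVlt => /orP[|xs].
    rewrite eq_sym mulf_eq0 (negbTE sg0)/= => /eqP /(front Ux).
    by move/frontierE => [].
  apply: subset_closure; have [_ <-] := UV _ Ux.
  exact: (@one_side rho sg y (f x)).
have nPs_in sg x : ~ Ps sg -> enorm (x - p) < r -> K x -> sg * phi x <= 0.
  move=> nP /Hr[Ux xp] Kx; rewrite leNgt; apply/negP => xs.
  apply: nP; exists (f x); split => //; have [_ ->] := UV _ Ux.
  apply: contrapT => nO; have /(front Ux) : frontier Omega x by apply/frontierE.
  by move=> x0; move: xs; rewrite /phi x0 mulr0 ltxx.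
have [P1|P1] := pselect (Ps 1); have [P2|P2] := pselect (Ps (-1)).
- exists 0, r; split => // x y xp yp _ _; apply: (@straight_bent_chord _ _ _ p r) => // z zp.
  have [h|h] := leP 0 (phi z).
    by apply: (Ps_in 1) => //; rewrite ?oner_eq0// mul1r.
  by apply: (Ps_in (-1)) => //; rewrite ?oppr_eq0 ?oner_eq0// mulN1r oppr_ge0 ltW.
- apply: (@chart_pushed 1 r) => //; [by left|by move=> x /Hr[]| |].
    by move=> x xp xs; apply: (Ps_in 1) => //; rewrite oner_eq0.
  by move=> x xp Kx; have := nPs_in _ x P2 xp Kx; rewrite mulN1r mul1r oppr_le0.
- apply: (@chart_pushed (-1) r) => //; [by right|by move=> x /Hr[]| |].
    by move=> x xp xs; apply: (Ps_in (-1)) => //; rewrite oppr_eq0 oner_eq0.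
  by move=> x xp Kx; have := nPs_in _ x P1 xp Kx; rewrite mulN1r mul1r oppr_ge0.
- have /frontierE[Kp _] := Fp.
  have [|z [Oz /= zp]] := Kp [set z | enorm (z - p) < r]; first by apply/nbhs_enormP; exists r.
  have Kz : K z by exact: subset_closure.
  have [Uz _] := Hr _ zp.
  have : frontier Omega z.
    apply/(front Uz)/eqP; rewrite eq_le.
    have := nPs_in _ z P1 zp Kz; have := nPs_in _ z P2 zp Kz.
    by rewrite mulN1r mul1r oppr_le0 => -> ->.
  by move/frontierE => [].
Qed.

End chart.

Hypothesis d0 : (0 < d)%N.
Hypothesis bd_C11 : C11_submanifold d.-1 (frontier Omega).
Hypothesis K_compact : compact K.

Lemma local_bent_chord p : K p -> exists C r : R, [/\ 0 <= C, 0 < r &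
  forall x y, enorm (x - p) < r -> enorm (y - p) < r -> K x -> K y -> bent_chord K C x y].
Proof.
move=> Kp; have [Op|nOp] := pselect (Omega p).
  have [C [r [C0 r0 H]]] := local_bent_chord_interior Op.
  by exists C, r; split => // x y xp yp _ _; exact: H.
have Fp : frontier Omega p by apply/frontierE.
have [_ /(_ _ Fp)[U [V [oU Up oV [f [g [fg front]]]]]]] := bd_C11.
have i0P : (d.-1 < d)%N by rewrite prednK.
apply: (@chart_bent_chord p U V f g (Ordinal i0P)) => // x Ux.
rewrite (front _ Ux); split => [/(_ (Ordinal i0P))|x0 i di]; first by apply => /=.
suff -> : i = Ordinal i0P by [].
by apply/val_inj/eqP => /=; rewrite eqn_leq di andbT -ltnS prednK.
Qed.

(** One integer [i] serves both as the constant and as the inverse of the radius,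
    so that compactness provides them at once. *)
Lemma uniform_bent_chord : exists C r : R, [/\ 0 <= C, 0 < r &
  forall x y, K x -> K y -> enorm (y - x) < r -> bent_chord K C x y].
Proof.
have near_inv (r : R) : 0 < r -> \forall i \near \oo, i.+1%:R^-1 < r :> R.
  move=> r0; exact: (near_infty_natSinv_lt (PosNum r0)).
have /compact_near_coveringP cov := K_compact.
have [|N _ HN] := cov nat \oo (fun i x => forall y, K x -> K y ->
    enorm (y - x) < i.+1%:R^-1 -> bent_chord K i%:R x y) _.
  move=> p Kp; have [C [r [C0 r0 H]]] := local_bent_chord Kp.
  exists ([set x | enorm (x - p) < r / 2], [set i : nat | C <= i%:R /\ i.+1%:R^-1 < r / 2]).
    split => /=; first by apply/nbhs_enormP; exists (r / 2) => //; lra.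
    by apply: filterI; [exact: nbhs_infty_ger|apply: near_inv; lra].
  move=> [x i] /= [xp [Ci ir]] y Kx Ky yx.
  apply: (@bent_chord_le _ _ K C) => //; apply: H => //; first lra.
  apply: (le_lt_trans (enorm_triangle x _ _)); rewrite (splitr r) ltrD//.
  exact: lt_trans yx ir.
exists N%:R, N.+1%:R^-1; split => // x y Kx Ky.
by apply: (HN N) => //=.
Qed.

End domain_geometry.

(** * Gluing and travelling along bent chords *)

Section lebesgue_measurability.
Set Implicit Arguments.
Unset Strict Implicit.
Context {R : realType}.

Notation lebesgueType :=
  (g_sigma_algebraType (completed_algebra_gen (@lebesgue_measure R))).

Definition lebesgue_measurable_fun (D : set R) (f : R -> R) :=
  @measurable_fun _ _ lebesgueType (measurableTypeR R) D f.

Lemma borel_lebesgue_measurable (A : set R) :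
  measurable A -> @measurable _ lebesgueType A.
Proof.
move=> mA; apply: sub_sigma_algebra.
by exists A => //; exists set0; [exact: negligible_set0|rewrite setU0].
Qed.

Lemma borel_lebesgue_measurable_fun (D : set R) (f : R -> R) :
  measurable D -> measurable_fun D f -> lebesgue_measurable_fun D f.
Proof. by move=> mD mf _ Y mY; apply: borel_lebesgue_measurable; exact: mf. Qed.

Lemma lebesgue_measurable_funU (D E : set R) (f : R -> R) :
  measurable D -> measurable E -> lebesgue_measurable_fun D f ->
  lebesgue_measurable_fun E f -> lebesgue_measurable_fun (D `|` E) f.
Proof.
move=> mD mE mf mg; have [_ ] := @measurable_funU _ _ lebesgueType (measurableTypeR R)
  D E f (borel_lebesgue_measurable mD) (borel_lebesgue_measurable mE).
by apply; split.
Qed.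

Lemma lebesgue_measurable_funS (D E : set R) (f : R -> R) :
  measurable D -> measurable E -> D `<=` E -> lebesgue_measurable_fun E f ->
  lebesgue_measurable_fun D f.
Proof.
by move=> mD mE DE; apply: measurable_funS => //; exact: borel_lebesgue_measurable.
Qed.

Lemma measurable_nonneg : measurable [set t : R | 0 <= t].
Proof.
rewrite (_ : [set _ | _] = `[0, +oo[%classic); first exact: measurable_itv.
by apply/seteqP; split => t /=; rewrite in_itv /= andbT.
Qed.

Lemma eq_lebesgue_measurable_fun (D : set R) (f g : R -> R) :
  {in D, f =1 g} -> lebesgue_measurable_fun D f -> lebesgue_measurable_fun D g.
Proof. exact: (@eq_measurable_fun _ _ lebesgueType (measurableTypeR R) D f g). Qed.

End lebesgue_measurability.

Section almost_everywhere.
Set Implicit Arguments.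
Unset Strict Implicit.
Context {R : realType}.

Lemma ae_neq (b : R) : {ae @lebesgue_measure R, forall t : R, t != b}.
Proof.
exists [set b]; split => //; first exact: lebesgue_measure_set1.
by move=> t /= /negP; rewrite negbK => /eqP.
Qed.

Let ae_filter := ae_filter_ringOfSetsType (@lebesgue_measure R).

Lemma ae_imply (P Q : R -> Prop) : (forall t, P t -> Q t) ->
  {ae @lebesgue_measure R, forall t : R, P t} ->
  {ae @lebesgue_measure R, forall t : R, Q t}.
Proof. exact: (@filterS _ _ ae_filter). Qed.

Lemma ae_imply2 (P Q S : R -> Prop) : (forall t, P t -> Q t -> S t) ->
  {ae @lebesgue_measure R, forall t : R, P t} ->
  {ae @lebesgue_measure R, forall t : R, Q t} ->
  {ae @lebesgue_measure R, forall t : R, S t}.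
Proof. exact: (@filterS2 _ _ ae_filter). Qed.

Lemma ae_imply3 (P Q S T : R -> Prop) : (forall t, P t -> Q t -> S t -> T t) ->
  {ae @lebesgue_measure R, forall t : R, P t} ->
  {ae @lebesgue_measure R, forall t : R, Q t} ->
  {ae @lebesgue_measure R, forall t : R, S t} ->
  {ae @lebesgue_measure R, forall t : R, T t}.
Proof. exact: (@filterS3 _ _ ae_filter). Qed.

End almost_everywhere.

Section gluing.
Set Implicit Arguments.
Unset Strict Implicit.
Context {R : realType} {d : nat}.
Variables (Omega : set 'rV[R]_d) (k : R -> 'rV[R]_d -> R).
Let K := closure Omega.
Let mu := @lebesgue_measure R.

Lemma elipschitz_glue (f : R -> 'rV[R]_d) (b : R) : 0 <= b ->
  elipschitz_on [set t | 0 <= t <= b] f -> elipschitz_on [set t | b <= t] f ->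
  elipschitz_on [set t | 0 <= t] f.
Proof.
move=> b0 [M1 H1] [M2 H2]; exists (Num.max M1 M2).
have wlog_le s t : 0 <= s -> s <= t -> enorm (f s - f t) <= Num.max M1 M2 * `|s - t|.
  move=> s0 st.
  have m1 x : M1 * `|x| <= Num.max M1 M2 * `|x| by rewrite ler_wpM2r// le_max lexx.
  have m2 x : M2 * `|x| <= Num.max M1 M2 * `|x| by rewrite ler_wpM2r// le_max lexx orbT.
  have [tb|bt] := leP t b.
    by apply: (le_trans (H1 _ _ _ _)) => //=; rewrite ?s0 ?(le_trans st)// (le_trans s0 st).
  have [bs|sb] := leP b s.
    by apply: (le_trans (H2 _ _ _ _)) => //=; exact: ltW.
  apply: (le_trans (enorm_triangle (f b) _ _)).
  have -> : `|s - t| = `|s - b| + `|b - t|.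
    by rewrite !ler0_norm ?subr_le0 ?(ltW sb) ?(ltW bt)//; ring.
  rewrite mulrDr lerD//.
    by apply: (le_trans (H1 _ _ _ _)) => //=; rewrite ?s0 ?(ltW sb) ?b0 ?lexx.
  by apply: (le_trans (H2 _ _ _ _)) => //=; exact: ltW.
move=> s t /= s0 t0; have [st|ts] := leP s t; first exact: wlog_le.
by rewrite enormB distrC wlog_le// ltW.
Qed.

(** From the time [b] on, an admissible curve may be replaced by any curve [q] that
    respects the speed limit until the time [c], and then rests.  The control is
    [u] before [b], [w] between [b] and [c], and zero afterwards; the curve need
    not be differentiable at [b] and [c]. *)
Lemma Adm_glue (sigma q w : R -> 'rV[R]_d) (b c : R) :
  Adm Omega k sigma -> 0 <= b -> b <= c -> q b = sigma b ->
  (forall t, b <= t <= c -> K (q t)) ->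
  elipschitz_on [set t | b <= t <= c] q ->
  (forall t, b < t < c -> enorm (w t) <= 1) ->
  (forall t, b < t < c -> is_derive t (1 : R) q (k t (q t) *: w t)) ->
  (forall i t, b < t < c -> {for t, continuous (fun s => w s ord0 i)}) ->
  exists2 sigma', Adm Omega k sigma' &
    (forall t, t <= b -> sigma' t = sigma t) /\ (forall t, c <= t -> sigma' t = q c).
Proof.
move=> [sK slip [u [mu_ ub ue]]] b0 bc qb qK [M qlip] w1 dq wc.
pose sigma' t := if t <= b then sigma t else q (Num.min t c).
have E1 t : t <= b -> sigma' t = sigma t by rewrite /sigma' => ->.
have E2 t : b <= t -> sigma' t = q (Num.min t c).
  rewrite /sigma' le_eqVlt => /orP[/eqP <-|]; first by rewrite lexx min_l.
  by rewrite ltNge => /negbTE ->.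
have E2' t : b <= t -> t <= c -> sigma' t = q t by move=> bt tc; rewrite E2// min_l.
have E3 t : c <= t -> sigma' t = q c.
  by move=> ct; rewrite E2 ?min_r//; exact: le_trans ct.
exists sigma'; last by [].
have minbc t : b <= t -> b <= Num.min t c <= c.
  by move=> bt; rewrite le_min bt bc ge_min lexx orbT.
pose u' t := if t < b then u t else if (b < t) && (t < c) then w t else 0.
have U1 t : t < b -> u' t = u t by rewrite /u' => ->.
have U2 t : b < t -> t < c -> u' t = w t by rewrite /u' => bt tc; rewrite ltNge (ltW bt)/= bt tc.
have U3 t : c <= t -> u' t = 0.
  move=> ct; rewrite /u' ltNge (le_trans bc ct)/=.
  by rewrite (ltNge t c) ct andbF.
have U4 : u' b = 0 by rewrite /u' ltxx.
split.
- move=> t t0; have [tb|bt] := leP t b; first by rewrite E1//; exact: sK.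
  by rewrite E2 ?(ltW bt)//; apply/qK/minbc/ltW.
- apply: (elipschitz_glue b0).
    have [N HN] := slip; exists N => s t /andP[s0 sb] /andP[t0 tb].
    by rewrite !E1//; exact: HN.
  exists `|M| => s t /= bs bt; rewrite !E2//.
  apply: (le_trans (qlip _ _ (minbc _ bs) (minbc _ bt))).
  apply: (@le_trans _ _ (`|M| * `|Num.min s c - Num.min t c|)).
    by rewrite ler_wpM2r// ler_norm.
  rewrite ler_wpM2l//; rewrite ler_norml.
  have := ler_norm (s - t); have := ler_norm (t - s); rewrite (distrC t s) => h1 h2.
  by rewrite /Num.min; case: ifPn; case: ifPn; rewrite -?leNgt => *; apply/andP; split; lra.
- exists u'; split.
  + move=> i.
    have DE : [set t : R | 0 <= t] = `[0, b[ `|` ([set b] `|` `]b, c[) `|` `[c, +oo[.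
      apply/seteqP; split => t /=; rewrite !in_itv /= ?andbT.
        move=> t0; have [|bt|->] := ltgtP t b; [by left; left; rewrite t0| |by left; right; left].
        by have [tc|ct] := ltP t c; [left; right; right|right].
      case=> [[/andP[]//|[->//|/andP[/ltW bt _]]]|ct]; first exact: le_trans bt.
      by rewrite (le_trans b0)// (le_trans bc).
    rewrite DE; apply: lebesgue_measurable_funU => //.
    * by apply: measurableU => //; apply: measurableU.
    * apply: lebesgue_measurable_funU => //; first exact: measurableU.
        apply: (@eq_lebesgue_measurable_fun _ _ (fun t => u t ord0 i)).
          by move=> t; rewrite inE /= in_itv /= => /andP[_ /U1 ->].
        apply: lebesgue_measurable_funS (mu_ i) => //.
          exact: measurable_nonneg.
        by move=> t /=; rewrite in_itv /= => /andP[].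
      apply: lebesgue_measurable_funU => //.
        apply: borel_lebesgue_measurable_fun => //.
        exact: measurable_fun_set1.
      apply: (@eq_lebesgue_measurable_fun _ _ (fun t => w t ord0 i)).
        by move=> t; rewrite inE /= in_itv /= => /andP[bt tc]; rewrite U2.
      apply: borel_lebesgue_measurable_fun => //.
      apply: open_continuous_measurable_fun; first exact: interval_open.
      by move=> t; rewrite inE /= in_itv /= => /wc; exact.
    * apply: (@eq_lebesgue_measurable_fun _ _ (fun=> 0)).
        by move=> t; rewrite inE /= in_itv /= andbT => /U3 ->; rewrite mxE.
      by apply: borel_lebesgue_measurable_fun => //; exact: measurable_cst.
  + move=> t t0; have [tb|bt|tb] := ltgtP t b; first by rewrite U1//; exact: ub.
      have [tc|ct] := ltP t c; first by rewrite U2// /eclosed_ball /= w1// bt.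
      by rewrite U3// /eclosed_ball /= enorm0.
    by rewrite tb U4 /eclosed_ball /= enorm0.
  + have Nb : {ae mu, forall t : R, t != b}.
      exact: ae_neq.
    have Nc : {ae mu, forall t : R, t != c}.
      exact: ae_neq.
    move: ue Nb Nc; apply: ae_imply3 => t ut tb tc t0.
    have [tb'|bt|/eqP] := ltgtP t b; last by rewrite (negbTE tb).
      rewrite E1 ?(ltW tb')// U1//; apply: near_eq_is_derive (ut t0).
      by near=> s; rewrite E1//; apply/ltW; near: s; exact: lt_nbhsl.
    have [tc'|ct|/eqP] := ltgtP t c; last by rewrite (negbTE tc).
      rewrite E2' ?(ltW bt) ?(ltW tc')// U2//.
      apply: (@near_eq_is_derive _ _ _ q); last by apply: dq; rewrite bt.
      near=> s; rewrite E2'//; apply/ltW; near: s; [exact: lt_nbhsr|exact: lt_nbhsl].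
    rewrite U3 ?(ltW ct)// scaler0.
    have dcst : is_derive t (1 : R) (fun=> q c) 0.
      apply/is_derive_err => e e0; exists 1 => // s _.
      by rewrite scaler0 !subrr normr0 mulr_ge0// ltW.
    apply: near_eq_is_derive dcst.
    by near=> s; rewrite E3//; apply/ltW; near: s; exact: lt_nbhsr.
Unshelve. all: by end_near. Qed.

End gluing.

Section hops.
Set Implicit Arguments.
Unset Strict Implicit.
Context {R : realType} {d : nat}.
Variables (Omega : set 'rV[R]_d) (k : R -> 'rV[R]_d -> R) (Kmin Kmax : R).
Let K := closure Omega.
Hypothesis k_continuous : {within [set p : R * 'rV[R]_d | 0 <= p.1 /\ K p.2],
                       continuous (fun p => k p.1 p.2)}.
Hypothesis Kmin_gt0 : 0 < Kmin.
Hypothesis k_bounds : forall t x, 0 <= t -> K x -> Kmin <= k t x <= Kmax.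

Lemma speed_continuous (p : R -> R) (q : R -> 'rV[R]_d) (t : R) :
  (\forall s \near t, 0 <= p s /\ K (q s)) ->
  {for t, continuous p} -> {for t, continuous q} ->
  {for t, continuous (fun s => k (p s) (q s))}.
Proof.
move=> ptK pc qc; have [p0 qK] := nbhs_singleton ptK.
move/subspace_continuousP : k_continuous => /(_ (p t, q t)) /= /(_ (conj p0 qK)) kc.
move=> N /kc kN; have pq : (fun s => (p s, q s)) @ t --> (p t, q t) by exact: (cvg_pair pc qc).
have := pq _ kN; rewrite /nbhs /= => h; move: ptK h; apply: filterS2 => s sK; exact.
Qed.

Lemma Adm_wait (sigma : R -> 'rV[R]_d) (b : R) : Adm Omega k sigma -> 0 <= b ->
  exists2 sigma', Adm Omega k sigma' &
    (forall t, t <= b -> sigma' t = sigma t) /\ (forall t, b <= t -> sigma' t = sigma b).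
Proof.
move=> As b0; have [sK _ _] := As.
apply: (@Adm_glue R d Omega k sigma (fun=> sigma b) (fun=> 0) b b) => //.
- by move=> t _; exact: sK.
- by exists 0 => s t _ _; rewrite subrr enorm0 mul0r.
- by move=> t /andP[/lt_trans h /h]; rewrite ltxx.
- by move=> t /andP[/lt_trans h /h]; rewrite ltxx.
- by move=> i t /andP[/lt_trans h /h]; rewrite ltxx.
Qed.

Lemma enorm_sqr_orthogonal (e w : 'rV[R]_d) (a : R) : dot w e = 0 -> `|a| <= 1 ->
  enorm (e + a *: w) ^+ 2 <= enorm e ^+ 2 + enorm w ^+ 2.
Proof.
move=> we a1; rewrite enorm_sqr !dotE (dotC e w) we -!enorm_sqr.
have h : a ^+ 2 <= 1 by rewrite -real_normK ?num_real// expr_le1.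
have := ler_wpM2r (sqr_ge0 (enorm w)) h; rewrite mul1r expr2 => h'.
lra.
Qed.

(** Travel along a bent chord at a prescribed rate: [Z] plays the role of a
    clock, and the fraction of the chord covered at time [t] is
    [(Z t - Z b) / (Z c - Z b)].  The final hypothesis is the speed limit, [S] being
    an upper bound for the norm of the derivative of the parabola. *)
Lemma Adm_hop (sigma : R -> 'rV[R]_d) (b c S B : R) (y z w0 : 'rV[R]_d) (Z dZ : R -> R) :
  Adm Omega k sigma -> 0 <= b -> b <= c -> sigma b = y ->
  dot w0 (z - y) = 0 ->
  (forall s, 0 <= s <= 1 -> K (y + s *: (z - y) + (s * (1 - s)) *: w0)) ->
  0 <= S -> enorm (z - y) ^+ 2 + enorm w0 ^+ 2 <= S ^+ 2 ->
  (forall t, b <= t <= c -> is_derive t (1 : R) Z (dZ t)) ->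
  (forall t, b <= t <= c -> 0 <= dZ t <= B) ->
  (forall t, b < t < c -> {for t, continuous dZ}) ->
  Z b < Z c ->
  (forall t s, b < t < c -> 0 <= s <= 1 -> Z t = Z b + s * (Z c - Z b) ->
    S * dZ t <= (Z c - Z b) * k t (y + s *: (z - y) + (s * (1 - s)) *: w0)) ->
  exists2 sigma', Adm Omega k sigma' &
    (forall t, t <= b -> sigma' t = sigma t) /\ (forall t, c <= t -> sigma' t = z).
Proof.
move=> As b0 bc sby wz PK S0 SE HZ HdZ dZc Zbc HS.
set e := z - y in wz PK SE HS *.
set l := Z c - Z b in HS.
have l0 : 0 < l by rewrite subr_gt0.
pose lam t := (Z t - Z b) / l.
pose P (s : R) := y + s *: e + (s * (1 - s)) *: w0.
have Zlip s t : b <= s -> s <= t -> t <= c -> 0 <= Z t - Z s <= B * (t - s).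
  move=> bs st tc; have [|x /andP[sx xt] ->] := @mvt_cc R Z dZ s t st.
    by move=> x /andP[sx xt]; apply: HZ; rewrite (le_trans bs sx) (le_trans xt tc).
  have /andP[h1 h2] := HdZ x ltac:(by rewrite (le_trans bs sx) (le_trans xt tc)).
  by rewrite mulr_ge0 ?ler_wpM2r ?subr_ge0.
have lam01 t : b <= t <= c -> 0 <= lam t <= 1.
  move=> /andP[bt tc]; have /andP[h1 _] := Zlip _ _ (lexx b) bt tc.
  have /andP[h2 _] := Zlip _ _ bt tc (lexx c).
  by rewrite /lam divr_ge0 ?(ltW l0)//= ler_pdivrMr// mul1r lerD2r -subr_ge0.
have lam_d t : b <= t <= c -> is_derive t (1 : R) lam (dZ t / l).
  move=> /HZ /is_derive_err H; apply/is_derive_err => a a0.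
  have [|r r0 rH] := H (a * l); first by rewrite mulr_gt0.
  exists r => // s /rH h; rewrite /lam /GRing.scale /=.
  have -> : (Z s - Z b) / l - (Z t - Z b) / l - (s - t) * (dZ t / l) =
     (Z s - Z t - (s - t) *: dZ t) / l by rewrite /GRing.scale /=; lra.
  rewrite normrM normfV (gtr0_norm l0) ler_pdivrMr// (le_trans h)//; lra.
have q_d t : b <= t <= c -> is_derive t (1 : R) (P \o lam)
    ((dZ t / l) *: (e + (1 - 2 * lam t) *: w0)).
  move=> tbc; have dl := lam_d _ tbc.
  have dm : is_derive t (1 : R) (fun s => lam s * (1 - lam s)) ((dZ t / l) * (1 - 2 * lam t)).
    have d1 : is_derive t (1 : R) (fun s => 1 - lam s) (- (dZ t / l)).
      have := is_deriveB (is_derive_cst (1 : R) t (1 : R)) dl.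
      by rewrite sub0r.
    apply: is_derive_eq (is_deriveM dl d1) _.
    by rewrite /GRing.scale /=; ring.
  have := is_deriveD (is_deriveD (is_derive_cst y t (1 : R)) (is_derive_scale e dl))
    (is_derive_scale w0 dm).
  by move=> h; apply: (is_derive_eq h); rewrite add0r [RHS]scalerDr scalerA.
have q_c t : b <= t <= c -> {for t, continuous (P \o lam)}.
  by move=> /q_d[+ _] => /derivable1_diffP; exact: differentiable_continuous.
have qK t : b <= t <= c -> K (P (lam t)) by move=> /lam01; exact: PK.
have kpos t : b <= t <= c -> 0 < k t (P (lam t)).
  move=> tbc; have /andP[bt tc] := tbc.
  have /andP[h _] := k_bounds (le_trans b0 bt) (qK _ tbc).
  exact: lt_le_trans h.
pose w t := (k t (P (lam t)))^-1 *: ((dZ t / l) *: (e + (1 - 2 * lam t) *: w0)).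
have Pc : P (lam c) = z.
  by rewrite /P /lam divff ?gt_eqF// subrr mulr0 scale0r addr0 scale1r /e addrC subrK.
rewrite -Pc.
have ltW2 (t : R) : b < t < c -> b <= t <= c by move=> /andP[/ltW -> /ltW].
apply: (@Adm_glue R d Omega k sigma (P \o lam) w b c) => //.
- by rewrite /= /P /lam subrr mul0r scale0r mul0r scale0r !addr0.
- exists (B / l * (enorm e + enorm w0)).
  have le_case s t : b <= s -> s <= t -> t <= c ->
      enorm (P (lam s) - P (lam t)) <= B / l * (enorm e + enorm w0) * `|s - t|.
    move=> bs st tc.
    have sbc : b <= s <= c by rewrite bs (le_trans st).
    have tbc : b <= t <= c by rewrite tc (le_trans bs).
    have -> : P (lam s) - P (lam t) =
        (lam s - lam t) *: (e + (1 - lam s - lam t) *: w0).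
      by rewrite /P; apply/rowP => i; rewrite !mxE; ring.
    rewrite enormZ distrC (distrC s) mulrAC.
    have /andP[h1 h2] := Zlip _ _ bs st tc.
    have -> : `|lam t - lam s| = (Z t - Z s) / l.
      have -> : lam t - lam s = (Z t - Z s) / l by rewrite /lam; ring.
      by rewrite ger0_norm// divr_ge0// ltW.
    rewrite (ger0_norm (_ : 0 <= t - s)) ?subr_ge0//.
    apply: ler_pM; rewrite ?divr_ge0 ?enorm_ge0 ?(ltW l0)//.
      by rewrite mulrAC ler_pM2r ?invr_gt0.
    apply: (le_trans (enormD _ _)); rewrite lerD2l enormZ ler_piMl ?enorm_ge0//.
    have := lam01 _ sbc; have := lam01 _ tbc => /andP[? ?] /andP[? ?].
    by rewrite ler_norml; apply/andP; split; lra.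
  move=> s t /= /andP[bs sc] /andP[bt tc]; have [st|ts] := leP s t; first exact: le_case.
  by rewrite enormB distrC; apply: le_case => //; exact: ltW.
- move=> t tbc; have tbc' := ltW2 _ tbc; have k0 := kpos _ tbc'.
  have /andP[bt tc] := tbc'.
  have /andP[dZ0 _] := HdZ _ tbc'.
  rewrite /w enormZ gtr0_norm ?invr_gt0// ler_pdivrMl// mulr1 enormZ.
  rewrite ger0_norm ?divr_ge0 ?(ltW l0)// mulrAC ler_pdivrMr// (mulrC _ l).
  have lt1 := lam01 _ tbc'.
  have {HS} := HS t (lam t) tbc lt1; rewrite /lam divfK ?gt_eqF// addrC subrK => /(_ erefl).
  rewrite -/(lam t) -/(P _); apply: le_trans; rewrite mulrC ler_wpM2r//.
  apply: enorm_le => //; apply: le_trans SE.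
  rewrite -enorm_sqr; apply: enorm_sqr_orthogonal => //.
  by move: lt1 => /andP[? ?]; rewrite ler_norml; apply/andP; split; lra.
- move=> t tbc; rewrite /w scalerA divff ?gt_eqF ?kpos ?ltW2// scale1r.
  exact: q_d (ltW2 _ tbc).
- move=> i t tbc; have tbc' := ltW2 _ tbc; have /andP[bt tc] := tbc.
  have lc : {for t, continuous lam}.
    by have [+ _] := lam_d _ tbc' => /derivable1_diffP; exact: differentiable_continuous.
  have kc : {for t, continuous (fun s => k s (P (lam s)))}.
    apply: (@speed_continuous id (P \o lam)); [|exact: cvg_id|exact: q_c].
    near=> s; have sbc : b <= s <= c.
      by apply/andP; split; apply/ltW; near: s; [exact: lt_nbhsr|exact: lt_nbhsl].
    split; last exact: qK.
    by case/andP: sbc => bs _; exact: le_trans bs.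
  have -> : (fun s => w s ord0 i) = (fun s => (k s (P (lam s)))^-1 *
      ((dZ s / l) * (e ord0 i + (1 - 2 * lam s) * w0 ord0 i))).
    by apply/funext => s; rewrite /w !mxE.
  apply: cvgM; first by apply: cvgV => //; rewrite gt_eqF ?kpos.
  apply: cvgM; first by apply: cvgMl; exact: dZc.
  apply: cvgD; first exact: cvg_cst.
  apply: cvgMl; apply: cvgB; first exact: cvg_cst.
  by apply: cvgMr.
Unshelve. all: by end_near. Qed.

End hops.

(** * Reachable points, and finiteness of the value *)

Section reachability.
Set Implicit Arguments.
Unset Strict Implicit.
Context {R : realType} {d : nat}.
Variables (Omega Gamma : set 'rV[R]_d) (k : R -> 'rV[R]_d -> R) (Kmin Kmax : R).
Let K := closure Omega.
Hypothesis k_continuous : {within [set p : R * 'rV[R]_d | 0 <= p.1 /\ K p.2],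
                       continuous (fun p => k p.1 p.2)}.
Hypothesis Kmin_gt0 : 0 < Kmin.
Hypothesis k_bounds : forall t x, 0 <= t -> K x -> Kmin <= k t x <= Kmax.
Variables (t0 : R) (x0 : 'rV[R]_d).
Hypotheses (t0_ge0 : 0 <= t0) (x0K : K x0).

Definition reach (c : R) (z : 'rV[R]_d) :=
  exists2 sigma, Adm Omega k sigma & sigma t0 = x0 /\ sigma c = z.

Lemma reach_start : reach t0 x0.
Proof.
exists (fun=> x0); last by [].
split => //; first by exists 0 => s t _ _; rewrite subrr enorm0 mul0r.
exists (fun=> 0); split.
- move=> i; apply: borel_lebesgue_measurable_fun; first exact: measurable_nonneg.
  exact: measurable_cst.
- by move=> t _; rewrite /eclosed_ball /= enorm0.
- apply: (ae_imply _ (ae_neq 0)) => t _ _; rewrite scaler0.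
  apply/is_derive_err => e e0; exists 1 => // s _.
  by rewrite scaler0 !subrr normr0 mulr_ge0// ltW.
Qed.

Lemma reach_wait (b c : R) (z : 'rV[R]_d) : t0 <= b -> b <= c -> reach b z -> reach c z.
Proof.
move=> tb bc [s As [s0 sb]].
have [s' As' [E1 E2]] := Adm_wait As (le_trans t0_ge0 tb).
by exists s' => //; rewrite E1// E2// sb.
Qed.

Lemma reach_hop (b c B : R) (y z w : 'rV[R]_d) (Z dZ : R -> R) :
  reach b y -> t0 <= b -> b <= c ->
  dot w (z - y) = 0 ->
  (forall s, 0 <= s <= 1 -> K (y + s *: (z - y) + (s * (1 - s)) *: w)) ->
  (forall t, b <= t <= c -> is_derive t (1 : R) Z (dZ t)) ->
  (forall t, b <= t <= c -> 0 <= dZ t <= B) ->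
  (forall t, b < t < c -> {for t, continuous dZ}) ->
  Z b < Z c ->
  (forall t s, b < t < c -> 0 <= s <= 1 -> Z t = Z b + s * (Z c - Z b) ->
    Num.sqrt (enorm (z - y) ^+ 2 + enorm w ^+ 2) * dZ t <=
    (Z c - Z b) * k t (y + s *: (z - y) + (s * (1 - s)) *: w)) ->
  reach c z.
Proof.
move=> [sg As [s0 sb]] tb bc wz wK HZ HdZ dZc Zbc HS.
have [|s' As' [E1 E2]] := Adm_hop k_continuous Kmin_gt0 k_bounds As (le_trans t0_ge0 tb) bc sb
  wz wK (sqrtr_ge0 _) _ HZ HdZ dZc Zbc HS.
  have h : 0 <= enorm (z - y) ^+ 2 + enorm w ^+ 2 by apply: addr_ge0; exact: sqr_ge0.
  by rewrite (sqr_sqrtr h).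
by exists s' => //; rewrite E1// E2.
Qed.

Lemma reach_value (c : R) (z : 'rV[R]_d) : t0 <= c -> reach c z -> Gamma z ->
  (value Omega Gamma k t0 x0 <= (c - t0)%:E)%E.
Proof.
move=> tc [s As [s0 sc]] Gz.
apply: (@le_trans _ _ (exit_time Gamma t0 s)); first by apply: ereal_inf_lbound; exists s.
apply: ereal_inf_lbound; exists (c - t0) => //; split; first by rewrite subr_ge0.
by rewrite subrK sc.
Qed.

Variables (C r : R).
Hypothesis r_gt0 : 0 < r.
Hypothesis bent : forall x y, K x -> K y -> enorm (y - x) < r -> bent_chord K C x y.

Lemma reach_near (b : R) (y z : 'rV[R]_d) : t0 <= b -> K y -> K z -> enorm (z - y) < r ->
  reach b y -> exists2 c, t0 <= c & reach c z.
Proof.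
move=> tb Ky Kz zy yb; have [w [wz _ wK]] := bent Ky Kz zy.
pose S := Num.sqrt (enorm (z - y) ^+ 2 + enorm w ^+ 2).
have S0 : 0 <= S by exact: sqrtr_ge0.
(* The duration is chosen so long that the speed never exceeds [Kmin]. *)
pose l := S / Kmin + 1.
have l0 : 0 < l by rewrite ltr_wpDl// divr_ge0// ltW.
exists (b + l); first by rewrite (le_trans tb)// lerDl ltW.
apply: (@reach_hop b (b + l) 1 y z w id (fun=> 1)) => //.
- by rewrite lerDl ltW.
- by move=> t _; rewrite ler01 lexx.
- by move=> t _; exact: cvg_cst.
- by rewrite ltrDl.
move=> t s /andP[bt _] s01 _; rewrite mulr1 addrAC subrr add0r.
have /andP[h _] := k_bounds (le_trans t0_ge0 (le_trans tb (ltW bt))) (wK _ s01).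
apply: (@le_trans _ _ (l * Kmin)); last by rewrite ler_wpM2l// ltW.
by rewrite /l mulrDl divfK ?gt_eqF// -/S lerDl mul1r ltW.
Qed.

Hypothesis K_connected : connected K.

(** By [reach_near], the set of the points reached at some time and its complement
    in [K] are both open in [K]. *)
Lemma reach_everywhere z : K z -> exists2 c, t0 <= c & reach c z.
Proof.
move=> Kz; pose Rs := [set z | K z /\ exists2 c, t0 <= c & reach c z].
suff RsE : Rs = K by have [] : Rs z by rewrite RsE.
pose nb (E : set 'rV[R]_d) := [set x : 'rV[R]_d | exists2 y, E y & enorm (x - y) < r].
have onb E : open (nb E).
  rewrite openE => x [y Ey xy]; apply/nbhs_enormP.
  exists (r - enorm (x - y)); first by rewrite subr_gt0.
  move=> x' x'x; exists y => //; apply: (le_lt_trans (enorm_triangle x _ _)).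
  by rewrite -ltrBrDr.
apply: K_connected.
- by exists x0; split => //; exists t0 => //; exact: reach_start.
- exists (nb Rs) => //; apply/seteqP; split => [x Rx|x [Kx [y [Ky [b tb yb]] xy]]].
    by split; [case: Rx|exists x => //; rewrite subrr enorm0].
  by split => //; exact: (reach_near tb Ky Kx xy yb).
- exists (~` nb (K `\` Rs)); first exact: open_closedC.
  apply/seteqP; split => [x Rx|x [Kx nx]].
    split; first by case: Rx.
    move=> [y [Ky nRy] xy]; apply: nRy; split => //; have [Kx [b tb xb]] := Rx.
    by apply: (reach_near tb Kx Ky _ xb); rewrite enormB.
  apply: contrapT => nR; apply: nx; exists x; last by rewrite subrr enorm0.
  by split.
Qed.

End reachability.

Section antiderivative.
Set Implicit Arguments.
Unset Strict Implicit.
Context {R : realType}.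

Lemma continuous_antiderivative (a : R -> R) : continuous a ->
  exists A : R -> R, forall t : R, -1 < t -> is_derive t (1 : R) A (a t).
Proof.
move=> ac; exists (fun t => \int[lebesgue_measure]_(s in `[-1, t]) a s)%R => t t1.
have [||||dd dE] := @continuous_FTC1_closed R a (-1) t (t + 1).
- by rewrite ltrDl.
- apply: continuous_compact_integrable; first exact: segment_compact.
  exact: continuous_subspaceT.
- exact: t1.
- exact: ac.
by apply: DeriveDef; [exact: dd|rewrite -derive1E; exact: dE].
Qed.

End antiderivative.

(** * Optimal curves are almost as short as their chords *)

(** [a] is the speed limit along [gamma], and [A] an antiderivative of it.  The
    variable [A], rather than time or arc length, measures the progress along
    [gamma]: with respect to it, [gamma] is 1-Lipschitz and any competitor close to
    [gamma] may travel at a speed close to 1. *)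
Section optimality.
Set Implicit Arguments.
Unset Strict Implicit.
Context {R : realType} {d : nat}.
Variables (Omega : set 'rV[R]_d) (k : R -> 'rV[R]_d -> R) (Kmin Kmax L : R).
Let K := closure Omega.
Hypothesis k_continuous : {within [set p : R * 'rV[R]_d | 0 <= p.1 /\ K p.2],
                       continuous (fun p => k p.1 p.2)}.
Hypothesis Kmin_gt0 : 0 < Kmin.
Hypothesis k_bounds : forall t x, 0 <= t -> K x -> Kmin <= k t x <= Kmax.
Hypothesis L_gt0 : 0 < L.
Hypothesis k_lipschitz : forall t x1 x2, 0 <= t -> K x1 -> K x2 ->
  `|k t x1 - k t x2| <= L * enorm (x1 - x2).
Variables (t0 t1 : R) (x0 : 'rV[R]_d).
Hypotheses (t0_ge0 : 0 <= t0) (x0K : K x0).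
Variables (C r : R).
Hypotheses (C_ge0 : 0 <= C) (r_gt0 : 0 < r).
Hypothesis bent : forall x y, K x -> K y -> enorm (y - x) < r -> bent_chord K C x y.
Notation reach := (reach Omega k t0 x0).

Variables (gamma : R -> 'rV[R]_d) (a A : R -> R).
Hypothesis gammaK : forall t, 0 <= t -> K (gamma t).
Hypothesis aE : forall t, 0 <= t -> a t = k t (gamma t).
Hypothesis a_cont : continuous a.
Hypothesis A_der : forall t : R, -1 < t -> is_derive t (1 : R) A (a t).
Hypothesis gamma_A : forall s t, 0 <= s -> s <= t -> enorm (gamma t - gamma s) <= A t - A s.
Hypothesis gamma_reach : forall s, t0 <= s -> reach s (gamma s).
Hypothesis no_early : forall c, t0 <= c -> reach c (gamma t1) -> t1 <= c.

Lemma a_bounds t : 0 <= t -> Kmin <= a t <= Kmax.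
Proof. by move=> t_ge0; rewrite aE//; apply: k_bounds => //; exact: gammaK. Qed.

Lemma A_der0 (t : R) : 0 <= t -> is_derive t (1 : R) A (a t).
Proof. by move=> ?; apply: A_der; apply: lt_le_trans (_ : 0 <= t) => //; rewrite ltrN10. Qed.

Lemma A_bounds s t : 0 <= s -> s <= t -> Kmin * (t - s) <= A t - A s <= Kmax * (t - s).
Proof.
move=> s0 st; have [|x /andP[sx xt] ->] := @mvt_cc R A a s t st.
  by move=> x /andP[sx _]; apply: A_der0; exact: le_trans sx.
have /andP[h1 h2] := a_bounds (le_trans s0 sx).
by rewrite !ler_wpM2r// subr_ge0.
Qed.

Lemma A_lt s t : 0 <= s -> s < t -> A s < A t.
Proof.
move=> s0 st; rewrite -subr_gt0; have /andP[h _] := A_bounds s0 (ltW st).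
by apply: lt_le_trans h; rewrite mulr_gt0// subr_gt0.
Qed.

Lemma A_le s t : 0 <= s -> s <= t -> A s <= A t.
Proof. by move=> s0; rewrite le_eqVlt => /orP[/eqP->//|/(A_lt s0)/ltW]. Qed.

Lemma A_norm s t : 0 <= s -> 0 <= t -> enorm (gamma t - gamma s) <= `|A t - A s|.
Proof.
move=> s0 t0'; have [st|ts] := leP s t.
  by apply: (le_trans (gamma_A s0 st)); exact: ler_norm.
rewrite enormB distrC; apply: (le_trans (gamma_A t0' (ltW ts))); exact: ler_norm.
Qed.

Lemma speed_near t x : 0 <= t -> K x -> a t - L * enorm (x - gamma t) <= k t x.
Proof.
move=> t_ge0 Kx; have := k_lipschitz t_ge0 Kx (gammaK t_ge0).
by rewrite -aE// ler_norml => /andP[h _]; lra.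
Qed.

Lemma continuous_IVT (f : R -> R) (x y v : R) : x <= y ->
  (forall t, x <= t <= y -> {for t, continuous f}) -> f x <= v <= f y ->
  exists2 c, x <= c <= y & f c = v.
Proof.
move=> xy fc /andP[xv vy].
have [||c] := @IVT R f x y v xy.
- by apply: continuous_in_subspaceT => t; rewrite inE /= in_itv /=; exact: fc.
- by rewrite ge_min xv le_max vy orbT.
- by rewrite in_itv /= => ? ?; exists c.
Qed.

Lemma derive_continuous (f : R -> R) (t df : R) : is_derive t (1 : R) f df ->
  {for t, continuous f}.
Proof. by move=> [+ _] => /derivable1_diffP; exact: differentiable_continuous. Qed.

Lemma hop_norm_le (e w : 'rV[R]_d) (S : R) : 0 <= S ->
  enorm e ^+ 2 + enorm w ^+ 2 <= S ^+ 2 -> Num.sqrt (enorm e ^+ 2 + enorm w ^+ 2) <= S.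
Proof.
move=> S0 h; rewrite -(ger0_norm S0) -sqrtr_sqr; exact: ler_wsqrtr.
Qed.

(** Arriving at [gamma t] too early is contradictory, because the advance is never
    lost: one can follow [gamma] so as to be, at the time [s], at the place where
    the progress is [Z s], ahead of [A s] by a margin that decays exponentially at
    the rate [2 * L].  The decay makes the required speed smaller than the one of
    [gamma] by [2 * L] times the margin, whereas the speed limit at the advanced
    place is smaller by at most [L] times the margin.  What is left pays for
    replacing [gamma] by bent chords between points of a fine grid; as these are
    smooth curves, no change of time has to be performed in [gamma]. *)
Lemma no_advance t t' : t0 <= t' -> t' < t -> t <= t1 -> ~ reach t' (gamma t).
Proof.
have [[Kmin0 r0] [L0 C0]] := (conj (conj Kmin_gt0 r_gt0) (conj L_gt0 C_ge0)).
move=> t0t' t't; rewrite le_eqVlt => /orP[/eqP tE|tt1] rt'.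
  by rewrite tE in rt' t't; have := no_early t0t' rt'; rewrite leNgt t't.
have Kmax_gt0 : 0 < Kmax.
  by have /andP[h1 h2] := k_bounds t0_ge0 x0K; apply: lt_le_trans (le_trans h1 h2).
(* Waiting until [t''] makes the initial margin so small that [dZ] stays positive. *)
have [t'' t't'' [t''t t''s]] : exists2 t'', t' <= t'' & t'' < t /\ 4 * L * (Kmax * (t - t'')) <= Kmin.
  exists (Num.max t' (t - Kmin / (4 * L * Kmax))); first by rewrite le_max lexx.
  have h : 0 < Kmin / (4 * L * Kmax) by rewrite divr_gt0// !mulr_gt0.
  split; first by rewrite gt_max t't/= ltrBlDr ltrDl.
  rewrite mulrA -ler_pdivlMl ?mulr_gt0// [leRHS]mulrC.
  have : t - Kmin / (4 * L * Kmax) <= Num.max t' (t - Kmin / (4 * L * Kmax)).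
    by rewrite le_max lexx orbT.
  lra.
have t0t'' : t0 <= t'' by exact: le_trans t't''.
have t''0 : 0 <= t'' by exact: le_trans t0t''.
have {rt'} rt'' : reach t'' (gamma t) by exact: reach_wait rt'.
pose e := A t - A t''.
have e0 : 0 < e by rewrite subr_gt0 A_lt.
have eL : 4 * L * e <= Kmin.
  apply: le_trans t''s; rewrite ler_pM2l ?mulr_gt0//.
  by have /andP[_] := A_bounds t''0 (ltW t''t).
pose g s := expR (- (2 * L) * (s - t'')).
pose Z s := A s + e * g s.
pose dZ s := a s - 2 * L * (e * g s).
have g_der (s : R) : is_derive s (1 : R) g (- (2 * L) * g s).
  have d1 : is_derive s (1 : R) (fun s => - (2 * L) * (s - t'')) (- (2 * L)).
    apply/is_derive_err => x x0'; exists 1 => // s' _.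
    rewrite {1}/GRing.scale /=.
    rewrite [X in `|X|](_ : _ = 0); last ring.
    by rewrite normr0 mulr_ge0// ltW.
  have := @is_derive1_comp R expR _ s _ _ (is_derive_expR (- (2 * L) * (s - t''))) d1.
  by move=> dg; apply: (is_derive_eq dg); rewrite mulrC.
have Z_der (s : R) : 0 <= s -> is_derive s (1 : R) Z (dZ s).
  move=> s0; have := is_deriveD (A_der0 s0) (is_deriveZ e (g_der s)).
  by move=> h; apply: (is_derive_eq h); rewrite /dZ /GRing.scale /=; ring.
have g_gt0 s : 0 < g s by exact: expR_gt0.
have g_le1 s : t'' <= s -> g s <= 1.
  by move=> h; rewrite -expR0 ler_expR mulNr oppr_le0 mulr_ge0 ?subr_ge0// mulr_ge0// ltW.
have dZ_bounds s : t'' <= s -> 0 < dZ s <= Kmax.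
  move=> h; have s0 : 0 <= s by exact: le_trans h.
  have /andP[h1 h2] := a_bounds s0.
  have h3 : 0 <= L * (e * g s) by rewrite mulr_ge0 ?(ltW L_gt0)// mulr_ge0 ?ltW.
  have h4 : L * (e * g s) <= L * e.
    by rewrite ler_pM2l// ler_piMr ?(ltW e0)// g_le1.
  have -> : dZ s = a s - 2 * (L * (e * g s)) by rewrite /dZ; ring.
  have h5 : 4 * (L * e) <= Kmin by rewrite mulrA.
  by apply/andP; split; lra.
have Z_cont s : 0 <= s -> {for s, continuous Z} by move=> /Z_der; exact: derive_continuous.
have dZ_cont s : {for s, continuous dZ}.
  apply: cvgB; first exact: a_cont.
  apply: cvgM; first exact: cvg_cst.
  by apply: cvgM; [exact: cvg_cst|exact: derive_continuous (g_der s)].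
pose del := e * g t1.
have del0 : 0 < del by rewrite mulr_gt0.
have del_le s : t'' <= s -> s <= t1 -> del <= Z s - A s.
  move=> _ st1; rewrite /Z addrAC subrr add0r ler_pM2l// ler_expR.
  by rewrite ler_wnM2l ?lerD2r// oppr_le0 mulr_ge0// ltW.
(* The progress during a step is at most [m]; the three terms make the bent chord
   exist, bound its correction by its length, and make its errors smaller than what
   the margin leaves. *)
pose m := Num.min (r / 2) (Num.min (1 / (C + 1)) (L * del / (C * Kmax + 3 * L))).
have CK0 : 0 < C * Kmax + 3 * L by rewrite ltr_wpDl ?mulr_ge0 ?(ltW Kmax_gt0)// mulr_gt0.
have C1 : 0 < C + 1 by rewrite ltr_wpDl.
have m0 : 0 < m by rewrite !lt_min !divr_gt0// mulr_gt0.
have mr : m < r by apply: (@le_lt_trans _ _ (r / 2)); [rewrite ge_min lexx|lra].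
have mC : C * m <= 1.
  have : m <= 1 / (C + 1) by rewrite ge_min ge_min lexx orbT.
  rewrite ler_pdivlMr// mulrDr mulr1 => h.
  by rewrite mulrC; apply: le_trans h; rewrite lerDl ltW.
have mL : (C * Kmax + 3 * L) * m <= L * del.
  have : m <= L * del / (C * Kmax + 3 * L) by rewrite ge_min ge_min lexx !orbT.
  by rewrite ler_pdivlMr// mulrC.
pose N := (Num.bound (Kmax * (t1 - t) / m)).+1.
have N0 : 0 < N%:R :> R by rewrite ltr0n.
have Nm : Kmax * ((t1 - t) / N%:R) <= m.
  rewrite mulrA ler_pdivrMr// [leRHS]mulrC -ler_pdivrMr//; apply: ltW.
  apply: (@lt_le_trans _ _ (Num.bound (Kmax * (t1 - t) / m))%:R); last by rewrite ler_nat.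
  by apply: archi_boundP; rewrite divr_ge0 ?(ltW m0)// mulr_ge0 ?subr_ge0 ?(ltW Kmax_gt0) ?(ltW tt1).
pose h := (t1 - t) / N%:R.
have h0 : 0 < h by rewrite divr_gt0// subr_gt0.
pose tau i := t + i%:R * h.
have tauS i : tau i.+1 = tau i + h by rewrite /tau -natr1; ring.
have tau_ge i : t <= tau i by rewrite lerDl mulr_ge0// ltW.
have tauN : tau N = t1 by rewrite /tau /h mulrC divfK ?gt_eqF// addrC subrK.
have tau_le i : (i <= N)%N -> tau i <= t1.
  by move=> iN; rewrite -tauN lerD2l ler_pM2r// ler_nat.
have t_ge0 : 0 <= t by rewrite (le_trans t''0)// ltW.
have tau0 i : 0 <= tau i by rewrite (le_trans t_ge0).
suff steps i : (i <= N)%N -> exists2 s, t'' <= s < tau i & Z s = A (tau i) /\ reach s (gamma (tau i)).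
  have [s /andP[ts st1] [_ rs]] := steps N (leqnn N).
  rewrite tauN in st1 rs.
  by have := no_early (le_trans t0t'' ts) rs; rewrite leNgt st1.
elim: i => [_|i IH iN].
  exists t''; rewrite /tau mul0r addr0; first by rewrite lexx.
  by rewrite /Z /g subrr mulr0 expR0 mulr1 /e addrC subrK.
have [s /andP[t''s' s_tau] [Zs rs]] := IH (ltnW iN).
have s0 : 0 <= s by exact: le_trans t''s'.
have tauSl : tau i < tau i.+1 by rewrite tauS ltrDl.
have s_tauS : s <= tau i.+1 by rewrite ltW// (lt_trans s_tau).
have AtauS : A (tau i) < A (tau i.+1) by apply: A_lt.
have ZtauS : A (tau i.+1) < Z (tau i.+1).
  by rewrite /Z ltrDl mulr_gt0.
have [s' /andP[ss' s'tau] Zs'] : exists2 s', s <= s' <= tau i.+1 & Z s' = A (tau i.+1).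
  apply: continuous_IVT => // [x /andP[sx _]|]; first by apply: Z_cont; exact: le_trans sx.
  by rewrite Zs (ltW AtauS) ltW.
have s'_lt : s' < tau i.+1.
  rewrite lt_neqAle s'tau andbT; apply/eqP => E.
  by move: ZtauS; rewrite -E Zs' E ltxx.
exists s'; first by rewrite (le_trans t''s' ss').
split => //.
set y := gamma (tau i); set z := gamma (tau i.+1).
have l_eq : Z s' - Z s = A (tau i.+1) - A (tau i) by rewrite Zs' Zs.
set l := A (tau i.+1) - A (tau i) in l_eq.
have l0 : 0 < l by rewrite subr_gt0.
have lm : l <= m.
  apply: le_trans Nm; have /andP[_] := A_bounds (tau0 i) (ltW tauSl).
  by have -> : tau i.+1 - tau i = h by rewrite tauS addrAC subrr add0r.
have yz : enorm (z - y) <= l by apply: gamma_A => //; exact: ltW.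
have [w [wz wC wK]] := bent (gammaK (tau0 i)) (gammaK (tau0 i.+1)) (le_lt_trans yz (le_lt_trans lm mr)).
rewrite -/y -/z in wz wC wK.
have Cl : C * l <= 1 by apply: le_trans mC; rewrite ler_wpM2l.
have wl : enorm w <= C * l * l.
  apply: (le_trans wC); rewrite -mulrA ler_wpM2l// -expr2.
  by rewrite ler_pXn2r ?nnegrE ?enorm_ge0// ltW.
have wl' : enorm w <= l by apply: (le_trans wl); rewrite ler_piMl// ltW.
have S_le : Num.sqrt (enorm (z - y) ^+ 2 + enorm w ^+ 2) <= l * (1 + C * l).
  have ez := enorm_ge0 (z - y); have ew := enorm_ge0 w.
  apply: (@le_trans _ _ (enorm (z - y) + enorm w)); last lra.
  apply: hop_norm_le; first by rewrite addr_ge0.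
  by rewrite sqrrD lerD2r lerDl mulrn_wge0// mulr_ge0.
apply: (@reach_hop R d Omega k Kmin Kmax k_continuous Kmin_gt0 k_bounds t0 x0 t0_ge0
  s s' Kmax y z w Z dZ) => //.
- exact: le_trans t''s'.
- by move=> x /andP[sx _]; apply: Z_der; exact: le_trans sx.
- move=> x /andP[sx _]; have /andP[p1 p2] := dZ_bounds _ (le_trans t''s' sx).
  by rewrite (ltW p1).
- by rewrite Zs Zs'.
move=> x la /andP[sx xs'] la01 Zx; rewrite l_eq in Zx *.
set p := y + _ + _.
have t''x : t'' <= x by rewrite (le_trans t''s')// ltW.
have x_ge0 : 0 <= x by exact: le_trans t''x.
have xt1 : x <= t1 by rewrite (le_trans (ltW xs'))// (le_trans s'tau)// tau_le.
have /andP[dZ0 dZK] := dZ_bounds _ t''x.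
have /andP[la0 la1] := la01.
have pK : K p by exact: wK.
have ZA := del_le _ t''x xt1.
have py : enorm (p - y) <= 2 * l.
  have -> : p - y = la *: (z - y) + (la * (1 - la)) *: w.
    by rewrite /p; apply/rowP => j; rewrite !mxE; ring.
  apply: (le_trans (enormD _ _)); rewrite !enormZ (ger0_norm la0).
  have q : `|la * (1 - la)| <= 1.
    by rewrite ger0_norm ?mulr_ge0 ?subr_ge0// mulr_ile1 ?subr_ge0// gerBl.
  have q1 : la * enorm (z - y) <= l.
    by apply: le_trans yz; rewrite ler_piMl ?enorm_ge0.
  have q2 : `|la * (1 - la)| * enorm w <= l.
    by apply: le_trans wl'; rewrite ler_piMl ?enorm_ge0.
  lra.
have yg : enorm (y - gamma x) <= (Z x - A x) + l.
  apply: (le_trans (A_norm x_ge0 (tau0 i))).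
  have ll : la * l <= l by rewrite ler_piMl// ltW.
  have ll0 : 0 <= la * l by rewrite mulr_ge0// ltW.
  rewrite Zs in Zx; rewrite ler_norml; apply/andP; split; lra.
have kp := speed_near x_ge0 pK.
have pg : L * enorm (p - gamma x) <= L * ((Z x - A x) + 3 * l).
  rewrite ler_pM2l//; apply: (le_trans (enorm_triangle y _ _)); lra.
have dZx : dZ x = a x - 2 * L * (Z x - A x) by rewrite /dZ /Z addrAC subrr add0r.
have k_ge : dZ x * (1 + C * l) <= k x p.
  have q1 : dZ x * (C * l) <= Kmax * (C * l) by rewrite ler_wpM2r// mulr_ge0// ltW.
  have q2 : (C * Kmax + 3 * L) * l <= L * del.
    by apply: le_trans mL; rewrite ler_wpM2l// ltW.
  have q3 : L * del <= L * (Z x - A x) by rewrite ler_wpM2l// ltW.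
  rewrite mulrDr mulr1 {1}dZx; lra.
apply: (@le_trans _ _ (l * (1 + C * l) * dZ x)); first by rewrite ler_wpM2r// ltW.
by rewrite -mulrA ler_wpM2l ?(ltW l0)// mulrC.
Qed.

(** Stewart's identity for a point whose distances to the ends of the chord are at
    most the progress made from the one and left to the other. *)
Lemma chord_deviation s t x : 0 <= s -> s <= x -> x <= t -> s < t ->
  enorm (gamma x - (gamma s + ((A x - A s) / (A t - A s)) *: (gamma t - gamma s))) ^+ 2
  <= ((A t - A s) ^+ 2 - enorm (gamma t - gamma s) ^+ 2) / 4.
Proof.
move=> s0 sx xt st; have l0 : 0 < A t - A s by rewrite subr_gt0 A_lt.
set l := A t - A s in l0 *; set la := (A x - A s) / l.
have x0' : 0 <= x by exact: le_trans sx.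
have lal : A x - A s = la * l by rewrite divfK// gt_eqF.
have la_le : A t - A x = (1 - la) * l by rewrite mulrBl -lal mul1r /l; ring.
have la0 : 0 <= la by rewrite divr_ge0 ?(ltW l0)// subr_ge0 A_le.
have la1 : 0 <= 1 - la.
  by rewrite -(@pmulr_lge0 _ l)// -la_le subr_ge0 A_le.
rewrite stewart.
have e1 : enorm (gamma x - gamma s) ^+ 2 <= (la * l) ^+ 2.
  by rewrite ler_pXn2r ?nnegrE ?enorm_ge0 -?lal ?subr_ge0 ?A_le// gamma_A.
have e2 : enorm (gamma t - gamma x) ^+ 2 <= ((1 - la) * l) ^+ 2.
  by rewrite ler_pXn2r ?nnegrE ?enorm_ge0 -?la_le ?subr_ge0 ?A_le// gamma_A.
have e3 : enorm (gamma t - gamma s) ^+ 2 <= l ^+ 2.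
  by rewrite ler_pXn2r ?nnegrE ?enorm_ge0 ?(ltW l0)// gamma_A// ltW.
have q1 := ler_wpM2l la1 e1; have q2 := ler_wpM2l la0 e2.
have q3 : 0 <= (1 / 2 - la) ^+ 2 * (l ^+ 2 - enorm (gamma t - gamma s) ^+ 2).
  by rewrite mulr_ge0 ?sqr_ge0// subr_ge0.
move: q1 q2 q3; move: (enorm _ ^+ 2) (enorm _ ^+ 2) (enorm _ ^+ 2) => E3 E2 E1.
clearbody l la => q1 q2 q3.
have -> : (l ^+ 2 - E3) / 4 = (1 - la) * (la * l) ^+ 2 + la * ((1 - la) * l) ^+ 2
   - la * (1 - la) * E3 + (1 / 2 - la) ^+ 2 * (l ^+ 2 - E3) by field.
lra.
Qed.

Let c := L / Kmin.

(** The competitor travels along the bent chord from [gamma s] to [gamma t] so that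
    the covered fraction is [1 + eta] times the fraction of the progress made by
    [gamma].  Then it stays as close to [gamma] as [gamma] to its chord, up to
    [O(h ^ 2 + eta)], whence a bound from below for its speed limit.  If the
    inequality failed, this speed would suffice for some [eta > 0], and the
    competitor would arrive before the time [t], against [no_advance]. *)
Lemma shortcut s t : t0 <= s -> s < t -> t <= t1 -> A t - A s < r ->
  forall l h, l = A t - A s -> h = enorm (gamma t - gamma s) ->
  l - c * (Num.sqrt (l ^+ 2 - h ^+ 2) / 2 + C * h ^+ 2) * l <= h + C ^+ 2 * h ^+ 3.
Proof.
have [[Kmin0 r0] [L0 C0]] := (conj (conj Kmin_gt0 r_gt0) (conj L_gt0 C_ge0)).
move=> t0s st tt1 lr l h lE hE; rewrite leNgt; apply/negP => gap.
set D := Num.sqrt _ / 2 in gap.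
have s0 : 0 <= s by exact: le_trans t0s.
have t_ge0 : 0 <= t by rewrite (le_trans s0)// ltW.
have l0 : 0 < l by rewrite lE subr_gt0 A_lt.
have c0 : 0 < c by rewrite divr_gt0.
have cK : c * Kmin = L by rewrite /c divfK// gt_eqF.
have hl : h <= l by rewrite hE lE; apply: gamma_A => //; exact: ltW.
have h0 : 0 <= h by rewrite hE; exact: enorm_ge0.
have lh2 : h ^+ 2 <= l ^+ 2 by rewrite ler_pXn2r ?nnegrE// ltW.
have D0 : 0 <= D by rewrite divr_ge0// sqrtr_ge0.
have DE : D ^+ 2 = (l ^+ 2 - h ^+ 2) / 4.
  by rewrite exprMn sqr_sqrtr ?subr_ge0// exprVn; congr (_ / _); ring.
set S := h + C ^+ 2 * h ^+ 3 in gap.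
have S0 : 0 <= S by rewrite addr_ge0// mulr_ge0// exprn_ge0.
set De := D + C * h ^+ 2 in gap.
pose gp := l - c * De * l - S.
have gp0 : 0 < gp by rewrite subr_gt0.
pose eta := gp / (S + c * l * h + 1).
have den0 : 0 < S + c * l * h + 1.
  by rewrite ltr_wpDl// addr_ge0// mulr_ge0// mulr_ge0// ltW.
have eta0 : 0 < eta by rewrite divr_gt0.
have eta1 : 0 < 1 + eta by rewrite addr_gt0.
have etaE : (1 + eta) * S <= l * (1 - c * (De + eta * h)).
  have : eta * (S + c * l * h + 1) = gp by rewrite divfK// gt_eqF.
  by rewrite /gp => e; have := ltW eta0; lra.
pose l' := l / (1 + eta).
have l'0 : 0 < l' by rewrite divr_gt0.
have l'l : l' < l by rewrite ltr_pdivrMr// ltr_pMr// ltrDl.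
have l'E : l' * (1 + eta) = l by rewrite divfK// gt_eqF.
have [t' /andP[st' t't] At'] : exists2 t', s <= t' <= t & A t' = A s + l'.
  apply: continuous_IVT; first exact: ltW.
    by move=> x /andP[sx _]; exact: derive_continuous (A_der0 (le_trans s0 sx)).
  by rewrite lerDl (ltW l'0)/= addrC -lerBrDr -lE ltW.
have t'_lt : t' < t.
  rewrite lt_neqAle t't andbT; apply/eqP => E.
  by move: l'l; rewrite lE -E At' addrAC subrr add0r ltxx.
apply: (no_advance (le_trans t0s st') t'_lt tt1).
have [w [wz wC wK]] := bent (gammaK s0) (gammaK t_ge0) ltac:(by rewrite -hE (le_lt_trans hl)// lE).
rewrite -hE in wC.
have S_le : Num.sqrt (enorm (gamma t - gamma s) ^+ 2 + enorm w ^+ 2) <= S.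
  apply: hop_norm_le => //; rewrite -hE.
  have : enorm w ^+ 2 <= (C * h ^+ 2) ^+ 2.
    by rewrite ler_pXn2r ?nnegrE ?enorm_ge0// mulr_ge0// exprn_ge0.
  have -> : S ^+ 2 = h ^+ 2 + (C * h ^+ 2) ^+ 2 + (C ^+ 2 * h ^+ 4 + (C ^+ 2 * h ^+ 3) ^+ 2).
    by rewrite /S; ring.
  have : 0 <= C ^+ 2 * h ^+ 4 + (C ^+ 2 * h ^+ 3) ^+ 2.
    by rewrite addr_ge0 ?sqr_ge0// mulr_ge0 ?exprn_ge0.
  lra.
apply: (@reach_hop R d Omega k Kmin Kmax k_continuous Kmin_gt0 k_bounds t0 x0 t0_ge0
  s t' Kmax (gamma s) (gamma t) w A a) => //.
- exact: gamma_reach.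
- by move=> x /andP[sx _]; apply: A_der0; exact: le_trans sx.
- move=> x /andP[sx _]; have /andP[p1 p2] := a_bounds (le_trans s0 sx).
  by rewrite p2 (le_trans (ltW Kmin0)).
- by move=> x _; exact: a_cont.
- by rewrite At' ltrDl.
move=> x la /andP[sx xt'] la01; rewrite At' [A s + l' - A s]addrAC subrr add0r => Ax.
set p := gamma s + _ + _.
have x_ge0 : 0 <= x by rewrite (le_trans s0)// ltW.
have xt : x <= t by rewrite (le_trans (ltW xt')).
have pK : K p by exact: wK.
have /andP[la0 la1] := la01.
have /andP[a1 a2] := a_bounds x_ge0.
have pg : enorm (p - gamma x) <= De + eta * h.
  pose la' := (A x - A s) / l.
  have la'E : la' * (1 + eta) = la.
    have lal : la * l' * (1 + eta) = la * l by rewrite -mulrA l'E.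
    by rewrite /la' Ax addrAC subrr add0r mulrAC lal mulfK// gt_eqF.
  have la'0 : 0 <= la' by rewrite -(@pmulr_lge0 _ (1 + eta))// la'E.
  have la'1 : la' <= 1.
    by apply: le_trans la1; rewrite -la'E ler_peMr// lerDl ltW.
  have -> : p - gamma x = - (gamma x - (gamma s + la' *: (gamma t - gamma s))) +
      ((la - la') *: (gamma t - gamma s) + (la * (1 - la)) *: w).
    by rewrite /p; apply/rowP => j; rewrite !mxE; ring.
  apply: (le_trans (enormD _ _)); rewrite enormN.
  have q1 : enorm (gamma x - (gamma s + la' *: (gamma t - gamma s))) <= D.
    rewrite -(@ler_pXn2r _ 2) ?nnegrE ?enorm_ge0// DE /la' lE hE.
    exact: (chord_deviation s0 (ltW sx) xt st).
  have q2 : enorm ((la - la') *: (gamma t - gamma s) + (la * (1 - la)) *: w)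
      <= eta * h + C * h ^+ 2.
    apply: (le_trans (enormD _ _)); rewrite !enormZ; apply: lerD.
      rewrite -hE ler_wpM2r//.
      have -> : la - la' = la' * eta by rewrite -la'E; ring.
      have la'eta : 0 <= la' * eta by exact: mulr_ge0 la'0 (ltW eta0).
      by rewrite (ger0_norm la'eta) ler_piMl// ltW.
    apply: le_trans wC; rewrite ler_piMl ?enorm_ge0//.
    by rewrite ger0_norm ?mulr_ge0 ?subr_ge0// mulr_ile1 ?subr_ge0// gerBl.
  by rewrite /De; lra.
have kp : a x * (1 - c * (De + eta * h)) <= k x p.
  apply: le_trans (speed_near x_ge0 pK); rewrite mulrBr mulr1 lerD2l lerN2.
  rewrite -cK -mulrA [leRHS]mulrCA ler_pM2l//.
  apply: ler_pM => //; [exact: ltW|exact: enorm_ge0].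
apply: (@le_trans _ _ (S * a x)); first by rewrite ler_wpM2r// (le_trans _ a1)// ltW.
have q3 : S <= l' * (1 - c * (De + eta * h)).
  rewrite -(@ler_pM2l _ (1 + eta))// mulrA (mulrC (1 + eta) l') l'E.
  exact: etaE.
apply: (@le_trans _ _ (l' * (1 - c * (De + eta * h)) * a x)).
  by rewrite ler_wpM2r// (le_trans _ a1)// ltW.
by rewrite -mulrA ler_pM2l// mulrC.
Qed.

Let E := C ^+ 2 + c * C.
Let F := c + E + 1.

Let c_gt0 : 0 < c.
Proof. by rewrite /c divr_gt0. Qed.

Let E_ge0 : 0 <= E.
Proof. by rewrite /E addr_ge0 ?sqr_ge0// mulr_ge0// ltW. Qed.

Let F_ge0 : 0 <= F.
Proof. by rewrite /F addr_ge0// addr_ge0// ltW. Qed.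

(** With [D ^ 2 = (l ^ 2 - h ^ 2) / 4], the previous lemma says that
    [l - h <= l * (c * D + E * l ^ 2)], and [4 * D ^ 2 <= 2 * l * (l - h)].  Hence
    [D] satisfies a quadratic inequality, which forces [D <= F * l ^ 2]. *)
Lemma deviation_bound s t : t0 <= s -> s < t -> t <= t1 -> A t - A s < r ->
  forall l h, l = A t - A s -> h = enorm (gamma t - gamma s) ->
  (l ^+ 2 - h ^+ 2) / 4 <= (F * l ^+ 2) ^+ 2.
Proof.
have [[Kmin0 r0] [L0 C0]] := (conj (conj Kmin_gt0 r_gt0) (conj L_gt0 C_ge0)).
move=> t0s st tt1 lr l h lE hE; have := shortcut t0s st tt1 lr lE hE.
set D := Num.sqrt _ / 2 => H.
have s0 : 0 <= s by exact: le_trans t0s.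
have l0 : 0 < l by rewrite lE subr_gt0 A_lt.
have c0 : 0 < c by rewrite divr_gt0.
have hl : h <= l by rewrite hE lE; apply: gamma_A => //; exact: ltW.
have h0 : 0 <= h by rewrite hE; exact: enorm_ge0.
have h2l : h ^+ 2 <= l ^+ 2 by rewrite ler_pXn2r ?nnegrE// ltW.
have h3l : h ^+ 3 <= l ^+ 3 by rewrite ler_pXn2r ?nnegrE// ltW.
have D0 : 0 <= D by rewrite divr_ge0// sqrtr_ge0.
have DE : D ^+ 2 = (l ^+ 2 - h ^+ 2) / 4.
  by rewrite exprMn sqr_sqrtr ?subr_ge0// exprVn; congr (_ / _); ring.
rewrite -DE ler_pXn2r ?nnegrE//; last first.
  exact: mulr_ge0 F_ge0 (sqr_ge0 _).
rewrite leNgt; apply/negP => FD.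
have E0 := E_ge0.
have lh : l - h <= l * (c * D + E * l ^+ 2).
  have q1 : C ^+ 2 * h ^+ 3 <= C ^+ 2 * l ^+ 3 by rewrite ler_wpM2l ?sqr_ge0.
  have q2 : c * C * h ^+ 2 * l <= c * C * l ^+ 2 * l.
    by rewrite ler_wpM2r ?(ltW l0)// ler_wpM2l// mulr_ge0// ltW.
  have -> : l * (c * D + E * l ^+ 2) = c * D * l + C ^+ 2 * l ^+ 3 + c * C * l ^+ 2 * l.
    by rewrite /E; ring.
  lra.
have D4 : 4 * D ^+ 2 <= 2 * l ^+ 2 * (c * D + E * l ^+ 2).
  have -> : 4 * D ^+ 2 = (l - h) * (l + h) by rewrite DE; field.
  have -> : 2 * l ^+ 2 * (c * D + E * l ^+ 2) = l * (c * D + E * l ^+ 2) * (2 * l) by ring.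
  by apply: ler_pM; rewrite ?subr_ge0//; lra.
set X := F * l ^+ 2 in FD.
have l2 : 0 < l ^+ 2 by rewrite exprn_gt0.
have X0 : 0 < X by rewrite mulr_gt0// /F ltr_wpDl// addr_ge0// ltW.
have cX : c * l ^+ 2 <= X by rewrite ler_pM2r// /F; lra.
have EX : E * l ^+ 2 <= X by rewrite ler_pM2r// /F; lra.
have lX : l ^+ 2 <= X by rewrite ler_peMl ?(ltW l2)// /F; lra.
have q1 : c * l ^+ 2 * D <= X * D by rewrite ler_wpM2r.
have q2 : E * l ^+ 2 * l ^+ 2 <= X * X by apply: ler_pM => //; rewrite ?mulr_ge0// ltW.
have q3 : X * D < D * D by rewrite ltr_pM2r// (lt_trans X0).
have q4 : X * X < X * D by rewrite ltr_pM2l.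
move: D4; rewrite expr2; lra.
Qed.

Lemma gamma_chord s t x : t0 <= s -> s <= x -> x <= t -> s < t -> t <= t1 -> A t - A s < r ->
  enorm (gamma x - (gamma s + ((A x - A s) / (A t - A s)) *: (gamma t - gamma s)))
  <= F * (A t - A s) ^+ 2.
Proof.
move=> t0s sx xt st tt1 lr.
rewrite -(@ler_pXn2r _ 2) ?nnegrE ?enorm_ge0//; last exact: mulr_ge0 F_ge0 (sqr_ge0 _).
apply: (le_trans (chord_deviation (le_trans t0_ge0 t0s) sx xt st)).
exact: (deviation_bound t0s st tt1 lr erefl erefl).
Qed.

Lemma chord_length s t : t0 <= s -> s < t -> t <= t1 -> A t - A s < r ->
  (A t - A s) ^+ 2 * (1 - 4 * F ^+ 2 * (A t - A s) ^+ 2) <= enorm (gamma t - gamma s) ^+ 2.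
Proof.
move=> t0s st tt1 lr; have := deviation_bound t0s st tt1 lr erefl erefl.
move: (A t - A s) (enorm _) => l h /= H.
have -> : l ^+ 2 * (1 - 4 * F ^+ 2 * l ^+ 2) = l ^+ 2 - 4 * (F * l ^+ 2) ^+ 2 by ring.
lra.
Qed.

End optimality.

(** * From almost straight curves to Lipschitz directions *)

Section lipschitz_extension.
Set Implicit Arguments.
Unset Strict Implicit.
Context {R : realType} {n : nat}.

(** McShane's formula, coordinate by coordinate. *)
Lemma lipschitz_extension (G : set R) (f : R -> 'rV[R]_n) (M : R) :
  G !=set0 -> 0 <= M ->
  (forall s t, G s -> G t -> enorm (f s - f t) <= M * `|s - t|) ->
  exists (v : R -> 'rV[R]_n) (M' : R), [/\ 0 <= M',
    (forall s t, enorm (v s - v t) <= M' * `|s - t|) &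
    forall s, G s -> v s = f s].
Proof.
move=> [g0 Gg0] M0 flip.
pose S i t := [set f s ord0 i + M * `|t - s| | s in G].
pose v t : 'rV[R]_n := \row_i inf (S i t).
have fi s t i : G s -> G t -> f s ord0 i <= f t ord0 i + M * `|t - s|.
  move=> Gs Gt; have := le_trans (coord_le_enorm (f s - f t) i) (flip _ _ Gs Gt).
  by rewrite !mxE (distrC s t) ler_norml => /andP[_]; lra.
have Si_lb i t s : G s -> lbound (S i t) (f s ord0 i - M * `|t - s|).
  move=> Gs _ [s' Gs' <-].
  have := fi s s' i Gs Gs'.
  have h : M * `|s' - s| <= M * (`|t - s'| + `|t - s|).
    rewrite ler_wpM2l//; have := ler_normD (s' - t) (t - s).
    by rewrite addrA subrK (distrC s' t).
  lra.
have Sinf i t : has_inf (S i t).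
  by split; [exists (f g0 ord0 i + M * `|t - g0|); exists g0|
             exists (f g0 ord0 i - M * `|t - g0|); exact: Si_lb].
have vlip i s t : v s ord0 i <= v t ord0 i + M * `|s - t|.
  rewrite !mxE -lerBlDr; apply: lb_le_inf; first by have [] := Sinf i t.
  move=> _ [x Gx <-]; rewrite lerBlDr.
  apply: (@le_trans _ _ (f x ord0 i + M * `|s - x|)).
    by apply: ge_inf; [have [] := Sinf i s|exists x].
  rewrite -addrA lerD2l -mulrDr ler_wpM2l//.
  by have := ler_normD (t - x) (s - t); rewrite [t - x + _]addrC addrA subrK addrC.
exists v, (n%:R * M); split; first exact: mulr_ge0.
  move=> s t; apply: (le_trans (enorm_le_norm _)); rewrite -mulrA ler_wpM2l//.
  rewrite [leLHS]/Num.norm/= mx_normrE; apply/bigmax_leP; split; first exact: mulr_ge0.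
  move=> [i j] _ /=; rewrite (ord1 i) [X in `|X|]mxE [X in _ + X]mxE ler_norml.
  have := vlip j s t; have := vlip j t s; rewrite (distrC t s) => h1 h2.
  by apply/andP; split; lra.
move=> s Gs; apply/rowP => i; apply/eqP; rewrite mxE eq_le; apply/andP; split.
  by apply: ge_inf; [have [] := Sinf i s|exists s => //; rewrite subrr normr0 mulr0 addr0].
apply: lb_le_inf; first by have [] := Sinf i s.
by have := Si_lb i s s Gs; rewrite subrr normr0 mulr0 subr0.
Qed.

End lipschitz_extension.

(** [G] stands for the set of the interior times at which [gamma] has the
    derivative prescribed by its control; [Q s t] is the difference quotient of
    [gamma] with respect to the progress [A]. *)
Section regularity.
Set Implicit Arguments.
Unset Strict Implicit.
Context {R : realType} {d : nat}.
Variables (gamma u : R -> 'rV[R]_d) (a A : R -> R) (t0 t1 Kmin Kmax F r : R) (G : set R).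
Hypotheses (Kmin_gt0 : 0 < Kmin) (Kmax_gt0 : 0 < Kmax) (F_ge0 : 0 <= F) (r_gt0 : 0 < r).
Hypothesis A_bounds : forall s t, t0 <= s -> s <= t -> t <= t1 ->
  Kmin * (t - s) <= A t - A s <= Kmax * (t - s).
Hypothesis gamma_A : forall s t, t0 <= s -> s <= t -> t <= t1 ->
  enorm (gamma t - gamma s) <= A t - A s.
Hypothesis A_der : forall t : R, t0 <= t <= t1 -> is_derive t (1 : R) A (a t).
Hypothesis gamma_chord : forall s t x, t0 <= s -> s <= x -> x <= t -> s < t -> t <= t1 ->
  A t - A s < r ->
  enorm (gamma x - (gamma s + ((A x - A s) / (A t - A s)) *: (gamma t - gamma s)))
  <= F * (A t - A s) ^+ 2.
Hypothesis chord_length : forall s t, t0 <= s -> s < t -> t <= t1 -> A t - A s < r ->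
  (A t - A s) ^+ 2 * (1 - 4 * F ^+ 2 * (A t - A s) ^+ 2) <= enorm (gamma t - gamma s) ^+ 2.
Hypothesis G_in : forall t, G t -> t0 < t < t1.
Hypothesis G_dense : forall t e, t0 <= t <= t1 -> 0 < e -> exists2 s, G s & `|s - t| < e.
Hypothesis G_der : forall t : R, G t -> is_derive t (1 : R) gamma (a t *: u t).
Hypothesis u_le1 : forall t, G t -> enorm (u t) <= 1.

Let Q s t := (A t - A s)^-1 *: (gamma t - gamma s).
Let F1 := 2 * F * Kmax ^+ 2 / Kmin.

Let F1_ge0 : 0 <= F1.
Proof. by rewrite /F1 divr_ge0 ?(ltW Kmin_gt0)// mulr_ge0 ?sqr_ge0// mulr_ge0. Qed.

Lemma quotient_sym s t : Q s t = Q t s.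
Proof. by rewrite /Q -(opprB (A s)) -(opprB (gamma s)) invrN scaleNr scalerN opprK. Qed.

Lemma A_norm_bounds s t : t0 <= s <= t1 -> t0 <= t <= t1 ->
  Kmin * `|t - s| <= `|A t - A s| <= Kmax * `|t - s|.
Proof.
wlog st : s t / s <= t => [H|].
  by have [st|/ltW st] := leP s t; [exact: H|rewrite distrC (distrC (A t)) => *; exact: H].
move=> /andP[s0 _] /andP[_ t1'].
have := A_bounds s0 st t1'; have /andP[h _] := A_bounds s0 st t1'.
rewrite !ger0_norm ?subr_ge0// -subr_ge0.
by apply: le_trans h; rewrite mulr_ge0 ?subr_ge0// ltW.
Qed.

Lemma gamma_norm_bound s t : t0 <= s <= t1 -> t0 <= t <= t1 ->
  enorm (gamma t - gamma s) <= Kmax * `|t - s|.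
Proof.
wlog st : s t / s <= t => [H|].
  by have [st|/ltW st] := leP s t; [exact: H|rewrite distrC enormB => *; exact: H].
move=> /andP[s0 _] /andP[_ t1']; rewrite ger0_norm ?subr_ge0//.
by apply: (le_trans (gamma_A s0 st t1')); have /andP[] := A_bounds s0 st t1'.
Qed.

Lemma between_in s t (la : R) : t0 <= s <= t1 -> t0 <= t <= t1 -> 0 <= la <= 1 ->
  t0 <= s + la * (t - s) <= t1.
Proof.
move=> /andP[s0 s1] /andP[t0' t1'] /andP[l0 l1].
have -> : s + la * (t - s) = (1 - la) * s + la * t by ring.
have m0 : 0 <= 1 - la by rewrite subr_ge0.
have h1 := ler_wpM2l m0 s0; have h2 := ler_wpM2l m0 s1.
have h3 := ler_wpM2l l0 t0'; have h4 := ler_wpM2l l0 t1'.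
apply/andP; split; lra.
Qed.

(** Halving the interval changes the difference quotient by at most a multiple of
    its length: the deviation from the chord is quadratic, and the progress is
    comparable with time. *)
Lemma quotient_half p q : t0 <= p <= t1 -> t0 <= q <= t1 -> p != q -> `|A q - A p| < r ->
  enorm (Q p (p + 2^-1 * (q - p)) - Q p q) <= F1 * `|q - p|.
Proof.
move=> pI qI pq lr; have Kmin0 := Kmin_gt0.
set m := p + _ * _.
have mI : t0 <= m <= t1 by apply: between_in => //; lra.
have F0 := F_ge0.
have qp0 : 0 < `|q - p| by rewrite normr_gt0 subr_eq0 eq_sym.
have mp : `|m - p| = `|q - p| / 2.
  by rewrite /m addrAC subrr add0r normrM ger0_norm ?invr_ge0// mulrC.
have /andP[Am _] := A_norm_bounds pI mI.
have /andP[Aq1 Aq2] := A_norm_bounds pI qI.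
have Am0 : 0 < `|A m - A p| by apply: lt_le_trans Am; rewrite mp !mulr_gt0.
have Aq0 : 0 < `|A q - A p| by apply: lt_le_trans Aq1; rewrite mulr_gt0.
have key : enorm (gamma m - (gamma p + ((A m - A p) / (A q - A p)) *: (gamma q - gamma p)))
    <= F * (A q - A p) ^+ 2.
  have /andP[p0 p1] := pI; have /andP[q0 q1] := qI.
  have [pq'|qp] := ltP p q.
    apply: gamma_chord => //; rewrite /m; try lra.
    by move: lr; apply: le_lt_trans; exact: ler_norm.
  have {}qp : q < p by rewrite lt_neqAle eq_sym pq.
  have h : A p - A q < r by move: lr; rewrite distrC; apply: le_lt_trans; exact: ler_norm.
  have e : (A m - A p) / (A q - A p) = 1 - (A m - A q) / (A p - A q).
    have x : A q - A p != 0 by rewrite -normr_gt0.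
    have y : A p - A q != 0 by rewrite -normr_gt0 distrC.
    by field; rewrite y x.
  have -> : gamma m - (gamma p + ((A m - A p) / (A q - A p)) *: (gamma q - gamma p)) =
      gamma m - (gamma q + ((A m - A q) / (A p - A q)) *: (gamma p - gamma q)).
    by rewrite e; move: ((A m - A q) / (A p - A q)) => x; apply/rowP => j; rewrite !mxE; ring.
  have -> : (A q - A p) ^+ 2 = (A p - A q) ^+ 2 by ring.
  by apply: gamma_chord => //; rewrite /m; lra.
have E : Q p m - Q p q = (A m - A p)^-1 *:
    (gamma m - (gamma p + ((A m - A p) / (A q - A p)) *: (gamma q - gamma p))).
  have x : A m - A p != 0 by rewrite -normr_gt0.
  rewrite /Q [- (gamma p + _)]opprD addrA.
  by rewrite [RHS]scalerBr scalerA mulrA mulVf// mul1r.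
rewrite E enormZ normfV ler_pdivrMl//; apply: (le_trans key).
have -> : (A q - A p) ^+ 2 = `|A q - A p| ^+ 2 by rewrite real_normK ?num_real.
apply: (@le_trans _ _ (F * (Kmax * `|q - p|) ^+ 2)).
  by rewrite ler_wpM2l// ler_pXn2r// nnegrE mulr_ge0// ltW.
apply: (@le_trans _ _ (Kmin * `|m - p| * (F1 * `|q - p|))); last first.
  by rewrite ler_wpM2r// mulr_ge0.
rewrite mp /F1 le_eqVlt; apply/orP; left; apply/eqP.
by field; rewrite gt_eqF.
Qed.

Lemma quotient_limit p e : G p -> 0 < e -> exists2 del, 0 < del &
  forall x, t0 <= x <= t1 -> x != p -> `|x - p| < del -> enorm (Q p x - u p) <= e.
Proof.
move=> Gp e0; have Kmin0 := Kmin_gt0.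
have /andP[/ltW p0 /ltW p1] := G_in Gp.
have pI : t0 <= p <= t1 by rewrite p0.
have e1 : 0 < e * Kmin / 2 by rewrite divr_gt0// mulr_gt0.
have /is_derive_eerr/(_ _ e1)[r1 r10 H1] := G_der Gp.
have /is_derive_err/(_ _ e1)[r2 r20 H2] := A_der pI.
exists (Num.min r1 r2); first by rewrite lt_min r10.
move=> x xI xp; rewrite lt_min => /andP[/H1 h1 /H2 h2].
have xp0 : 0 < `|x - p| by rewrite normr_gt0 subr_eq0.
have /andP[Ax _] := A_norm_bounds pI xI.
have Ax0 : 0 < `|A x - A p| by apply: lt_le_trans Ax; rewrite mulr_gt0.
have -> : Q p x - u p = (A x - A p)^-1 *:
   ((gamma x - gamma p - (x - p) *: (a p *: u p)) - (A x - A p - (x - p) * a p) *: u p).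
  have h : A x - A p != 0 by rewrite -normr_gt0.
  rewrite /Q; apply/rowP => j; rewrite !mxE; field; exact: h.
rewrite enormZ normfV ler_pdivrMl//; apply: (le_trans (enormD _ _)).
rewrite enormN enormZ.
have h3 : `|A x - A p - (x - p) * a p| * enorm (u p) <= e * Kmin / 2 * `|x - p|.
  rewrite -[leRHS]mulr1; apply: ler_pM => //; [exact: enorm_ge0|exact: u_le1].
have h4 : e * (Kmin * `|x - p|) <= e * `|A x - A p| by rewrite ler_pM2l.
lra.
Qed.

(** Sum the geometric series of the changes caused by successive halvings. *)
Lemma quotient_control p q : G p -> t0 <= q <= t1 -> p != q -> `|A q - A p| < r ->
  enorm (Q p q - u p) <= 2 * F1 * `|q - p|.
Proof.
move=> Gp; have /andP[/ltW p0 /ltW p1] := G_in Gp.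
have F10 := F1_ge0; have Kmin0 := Kmin_gt0.
have pI : t0 <= p <= t1 by rewrite p0.
pose qn n q := p + (2^-1) ^+ n * (q - p).
have key n : forall q, t0 <= q <= t1 -> p != q -> `|A q - A p| < r ->
    enorm (Q p q - u p) <= 2 * F1 * `|q - p| + enorm (Q p (qn n q) - u p).
  elim: n => [|n IH] {}q qI pq qr.
    have -> : qn 0 q = q by rewrite /qn expr0; ring.
    by rewrite lerDr mulr_ge0// mulr_ge0.
  pose m := p + 2^-1 * (q - p).
  have mI : t0 <= m <= t1 by apply: between_in => //; lra.
  have mp : `|m - p| = `|q - p| / 2.
    by rewrite /m addrAC subrr add0r normrM ger0_norm ?invr_ge0// mulrC.
  have pm : p != m.
    by rewrite eq_sym -subr_eq0 -normr_gt0 mp divr_gt0// normr_gt0 subr_eq0 eq_sym.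
  have mr : `|A m - A p| < r.
    apply: le_lt_trans qr.
    have [pq'|qp] := leP p q.
      have h1 : p <= m by rewrite /m; lra.
      have h2 : m <= q by rewrite /m; lra.
      have /andP[_ q1] := qI; have /andP[_ m1] := mI; have /andP[m0 _] := mI.
      have /andP[b1 _] := A_bounds p0 h1 m1.
      have /andP[b2 _] := A_bounds m0 h2 q1.
      have c1 : 0 <= Kmin * (m - p) by rewrite mulr_ge0 ?subr_ge0// ltW.
      have c2 : 0 <= Kmin * (q - m) by rewrite mulr_ge0 ?subr_ge0// ltW.
      rewrite !ger0_norm; lra.
    have h1 : m <= p by rewrite /m; lra.
    have h2 : q <= m by rewrite /m; lra.
    have /andP[q0 _] := qI; have /andP[_ m1] := mI; have /andP[m0 _] := mI.
    have /andP[b1 _] := A_bounds m0 h1 p1.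
    have /andP[b2 _] := A_bounds q0 h2 m1.
    have c1 : 0 <= Kmin * (p - m) by rewrite mulr_ge0 ?subr_ge0// ltW.
    have c2 : 0 <= Kmin * (m - q) by rewrite mulr_ge0 ?subr_ge0// ltW.
    rewrite !ler0_norm; lra.
  have := IH m mI pm mr.
  have -> : qn n m = qn n.+1 q by rewrite /qn /m exprS; ring.
  have := quotient_half pI qI pq qr; rewrite -/m enormB => h1 h2.
  have := enorm_triangle (Q p m) (Q p q) (u p).
  have h3 : 2 * F1 * `|m - p| = F1 * `|q - p| by rewrite mp; field.
  rewrite h3 in h2; lra.
move=> qI pq qr; apply/ler_addgt0Pr => e e0.
have [del del0 H] := quotient_limit Gp e0.
have qp0 : 0 < `|q - p| by rewrite normr_gt0 subr_eq0 eq_sym.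
have [n nE] : exists n, (2^-1) ^+ n * `|q - p| < del.
  have : (fun n => (2^-1 : R) ^+ n) @ \oo --> (0 : R).
    by apply: cvg_expr; rewrite ger0_norm ?invr_ge0// invf_lt1// ltr1n.
  move=> /cvgrPdist_lt/(_ (del / `|q - p|)); rewrite divr_gt0// => /(_ isT)[n _ /(_ n (leqnn n))].
  rewrite sub0r normrN ger0_norm ?exprn_ge0 ?invr_ge0// ltr_pdivlMr// => h.
  by exists n.
apply: (le_trans (key n q qI pq qr)); rewrite lerD2l.
have n0 : 0 < (2^-1 : R) ^+ n by rewrite exprn_gt0// invr_gt0.
have n1 : (2^-1 : R) ^+ n <= 1 by rewrite exprn_ile1// ?invr_ge0// invf_le1// ler1n.
have qnp : `|qn n q - p| = (2^-1) ^+ n * `|q - p|.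
  by rewrite /qn addrAC subrr add0r normrM ger0_norm// ltW.
apply: H.
- by apply: between_in => //; rewrite (ltW n0).
- by rewrite -subr_eq0 -normr_gt0 qnp mulr_gt0.
- by rewrite qnp.
Qed.

(** Both directions are compared with the same difference quotient; for distant
    times, the bound [2] on the difference of the directions is enough. *)
Lemma control_lipschitz_ae s t : G s -> G t ->
  enorm (u s - u t) <= (4 * F1 + 2 * Kmax / r) * `|s - t|.
Proof.
move=> Gs Gt; have F10 := F1_ge0; have r0 := r_gt0; have K0 := Kmax_gt0.
have /andP[/ltW s0 /ltW s1] := G_in Gs; have /andP[/ltW t0' /ltW t1'] := G_in Gt.
have sI : t0 <= s <= t1 by rewrite s0.
have tI : t0 <= t <= t1 by rewrite t0'.
have [->|st] := eqVneq s t; first by rewrite !subrr enorm0 normr0 mulr0.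
have n0 : 0 <= `|s - t| by [].
have h0 : 0 <= 2 * Kmax / r * `|s - t| by rewrite !mulr_ge0 ?invr_ge0// ltW.
have h1 : 0 <= 4 * F1 * `|s - t| by rewrite mulr_ge0// mulr_ge0.
have [lr|lr] := ltP `|A t - A s| r.
  have q1 := quotient_control Gs tI st lr.
  have q2 : enorm (Q s t - u t) <= 2 * F1 * `|t - s|.
    rewrite quotient_sym distrC; apply: quotient_control => //; first by rewrite eq_sym.
    by rewrite distrC.
  have := enorm_triangle (Q s t) (u s) (u t); rewrite (enormB (u s) (Q s t)).
  rewrite (distrC t s) in q1 q2; lra.
have /andP[_ h2] := A_norm_bounds sI tI.
have h3 : 2 <= 2 * Kmax / r * `|s - t|.
  rewrite mulrAC ler_pdivlMr// -mulrA ler_pM2l// distrC; exact: le_trans h2.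
have := enorm_triangle 0 (u s) (u t); rewrite subr0 sub0r enormN.
have := u_le1 Gs; have := u_le1 Gt; lra.
Qed.

(** By [chord_length] the difference quotients at [s] have norm close to 1. *)
Lemma control_unit s : G s -> enorm (u s) = 1.
Proof.
move=> Gs; apply/eqP; rewrite eq_le u_le1//= leNgt; apply/negP => us.
have F10 := F1_ge0; have r0 := r_gt0; have K0 := Kmax_gt0; have Kmin0 := Kmin_gt0.
have /andP[s0 s1] := G_in Gs.
have sI : t0 <= s <= t1 by rewrite !ltW.
set e := 1 - enorm (u s); have e0 : 0 < e by rewrite subr_gt0.
pose B := 4 * F ^+ 2 * Kmax ^+ 2 + 2 * F1 + 1.
have B0 : 0 < B.
  have h : 0 <= 4 * F ^+ 2 * Kmax ^+ 2 by rewrite mulr_ge0 ?sqr_ge0// mulr_ge0 ?sqr_ge0.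
  by rewrite /B; lra.
pose h := Num.min (Num.min 1 (t1 - s)) (Num.min (r / (2 * Kmax)) (e / (2 * B))).
have h0 : 0 < h by rewrite !lt_min ltr01 subr_gt0 s1 !divr_gt0// mulr_gt0.
have h1 : h <= 1 by rewrite /h !ge_min lexx.
have h2 : h <= t1 - s by rewrite /h !ge_min lexx orbT.
have h3 : h <= r / (2 * Kmax) by rewrite /h !ge_min lexx !orbT.
have h4 : h <= e / (2 * B) by rewrite /h !ge_min lexx !orbT.
have tI : t0 <= s + h <= t1 by apply/andP; split; lra.
have /andP[tI0 tI1] := tI.
have sh : s < s + h by rewrite ltrDl.
have /andP[b1 b2] := A_bounds (ltW s0) (ltW sh) tI1.
have E : s + h - s = h by rewrite addrAC subrr add0r.
rewrite E in b1 b2.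
have Kh : Kmax * h <= r / 2.
  by rewrite mulrC -ler_pdivlMr// -mulrA -invfM.
set l := A (s + h) - A s in b1 b2.
have l0 : 0 < l by apply: lt_le_trans b1; rewrite mulr_gt0.
have lr : l < r by lra.
have q := quotient_control Gs tI (ltac:(by rewrite lt_eqF)) ltac:(by rewrite ger0_norm ?ltW).
rewrite E (gtr0_norm h0) in q.
have c := chord_length (ltW s0) sh tI1 lr.
rewrite -/l in c.
have QE : enorm (Q s (s + h)) ^+ 2 = enorm (gamma (s + h) - gamma s) ^+ 2 / l ^+ 2.
  by rewrite /Q -/l enormZ ger0_norm ?invr_ge0 ?(ltW l0)// exprMn exprVn mulrC.
have l2 : 0 < l ^+ 2 by rewrite exprn_gt0.
have c' : 1 - 4 * F ^+ 2 * l ^+ 2 <= enorm (Q s (s + h)) ^+ 2.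
  by rewrite QE ler_pdivlMr// mulrC.
have lK : 4 * F ^+ 2 * l ^+ 2 <= 4 * F ^+ 2 * Kmax ^+ 2 * h.
  rewrite -(mulrA (4 * F ^+ 2)); apply: ler_wpM2l; first by rewrite mulr_ge0// sqr_ge0.
  apply: (@le_trans _ _ ((Kmax * h) ^+ 2)).
    by rewrite ler_pXn2r ?nnegrE ?(ltW l0)// mulr_ge0// ltW.
  by rewrite exprMn ler_wpM2l ?sqr_ge0// expr2 ler_piMl// ltW.
have Q0 := enorm_ge0 (Q s (s + h)).
have Q1 : 1 - 4 * F ^+ 2 * l ^+ 2 <= enorm (Q s (s + h)).
  have [//|Q1] := leP (1 - 4 * F ^+ 2 * l ^+ 2) (enorm (Q s (s + h))).
  have y0 : 0 <= 4 * F ^+ 2 * l ^+ 2 by rewrite mulr_ge0 ?sqr_ge0// mulr_ge0 ?sqr_ge0.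
  have : enorm (Q s (s + h)) ^+ 2 < 1 - 4 * F ^+ 2 * l ^+ 2.
    apply: (le_lt_trans _ Q1); rewrite expr2 ler_piMl//; lra.
  by rewrite ltNge c'.
have := enorm_triangle (u s) (Q s (s + h)) 0; rewrite !subr0 => tri.
have hB : B * h <= e / 2.
  by rewrite mulrC -ler_pdivlMr// -mulrA -invfM.
have BE : B * h = 4 * F ^+ 2 * Kmax ^+ 2 * h + 2 * F1 * h + h by rewrite /B; ring.
rewrite /e in hB e0; lra.
Qed.

(** For [t] in [G] this follows from [quotient_control]; any other [t] is replaced by a point
    of [G] at a distance of the order of [`|q - t| ^+ 2], which costs an error of
    that order. *)
Lemma gamma_quadratic (v : R -> 'rV[R]_d) (M : R) : 0 <= M ->
  (forall s t, enorm (v s - v t) <= M * `|s - t|) -> (forall s, G s -> v s = u s) ->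
  exists B del : R, 0 < del /\ forall t q, t0 <= t <= t1 -> t0 <= q <= t1 -> `|q - t| < del ->
    enorm (gamma q - gamma t - (A q - A t) *: v t) <= B * `|q - t| ^+ 2.
Proof.
move=> M0 vlip vE.
have F10 := F1_ge0; have r0 := r_gt0; have K0 := Kmax_gt0.
exists (2 * Kmax + Kmax * M + 2 * F1 * 2 * (Kmax * 2)), (Num.min 1 (r / (2 * Kmax))).
split; first by rewrite lt_min ltr01 divr_gt0// mulr_gt0.
move=> t q tI qI; rewrite lt_min => /andP[qt1 qtr].
have [->|qt] := eqVneq q t.
  by rewrite !subrr scale0r subr0 enorm0 normr0 expr0n mulr0.
set h := `|q - t| in qt1 qtr *.
have h0 : 0 < h by rewrite normr_gt0 subr_eq0.
have h20 : 0 < h ^+ 2 / 2 by rewrite divr_gt0// exprn_gt0.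
have h2h : h ^+ 2 <= h by rewrite expr2 ler_piMl// ltW.
have [s Gs st] := G_dense tI h20.
have /andP[/ltW s0 /ltW s1] := G_in Gs.
have sI : t0 <= s <= t1 by rewrite s0.
have qs : `|q - s| <= 2 * h.
  by have := ler_normD (q - t) (t - s); rewrite addrA subrK -/h (distrC t s); lra.
have sq : s != q.
  apply/eqP => sq; move: st; rewrite sq -/h; lra.
have Kqs : Kmax * `|q - s| < r.
  apply: (@le_lt_trans _ _ (Kmax * (2 * h))); first by rewrite ler_pM2l.
  by rewrite mulrCA mulrA mulrC -ltr_pdivlMr// mulr_gt0.
have /andP[Al Au] := A_norm_bounds sI qI.
have qc := quotient_control Gs qI sq (le_lt_trans Au Kqs).
have Aqs : A q - A s != 0.
  rewrite -normr_gt0; apply: lt_le_trans Al; rewrite mulr_gt0 ?Kmin_gt0//.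
  by rewrite normr_gt0 subr_eq0 eq_sym.
have e1 : enorm (gamma q - gamma s - (A q - A s) *: u s) <= 2 * F1 * 2 * (Kmax * 2) * h ^+ 2.
  have -> : gamma q - gamma s - (A q - A s) *: u s = (A q - A s) *: (Q s q - u s).
    by rewrite /Q scalerBr scalerA divff// scale1r.
  rewrite enormZ mulrC.
  have -> : 2 * F1 * 2 * (Kmax * 2) * h ^+ 2 = (2 * F1 * (2 * h)) * (Kmax * (2 * h)) by ring.
  apply: ler_pM; rewrite ?enorm_ge0//.
    by apply: (le_trans qc); rewrite ler_wpM2l// mulr_ge0.
  by apply: (le_trans Au); rewrite ler_pM2l.
have -> : gamma q - gamma t - (A q - A t) *: v t =
  (gamma q - gamma s - (A q - A s) *: u s) + (gamma s - gamma t) +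
  ((A q - A t) *: (u s - v t) - (A s - A t) *: u s).
  by apply/rowP => j; rewrite !mxE; ring.
have e2 : enorm (gamma s - gamma t) <= Kmax * (h ^+ 2 / 2).
  by apply: (le_trans (gamma_norm_bound tI sI)); rewrite ler_pM2l// ltW.
have e3 : enorm ((A q - A t) *: (u s - v t)) <= Kmax * M * h ^+ 2.
  rewrite enormZ; have /andP[_ Aqt] := A_norm_bounds tI qI.
  have -> : Kmax * M * h ^+ 2 = (Kmax * h) * (M * h) by ring.
  apply: ler_pM; rewrite ?enorm_ge0// -vE//.
  apply: (le_trans (vlip _ _)); rewrite ler_wpM2l//; lra.
have e4 : enorm ((A s - A t) *: u s) <= Kmax * (h ^+ 2 / 2).
  rewrite enormZ; have /andP[_ Ast] := A_norm_bounds tI sI.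
  rewrite -[leRHS]mulr1; apply: ler_pM; rewrite ?enorm_ge0 ?u_le1//.
  by apply: (le_trans Ast); rewrite ler_pM2l// ltW.
apply: (le_trans (enormD _ _)); apply: (le_trans (lerD (enormD _ _) (enormD _ _))).
rewrite enormN; have hh : 0 <= h ^+ 2 by rewrite sqr_ge0.
have Kh : 0 <= Kmax * h ^+ 2 by rewrite mulr_ge0// ltW.
lra.
Qed.

Hypothesis t01 : t0 < t1.
Hypothesis a_cont : continuous a.

(** The extension of the direction [u] from the dense set [G] keeps norm 1 by
    continuity, and [gamma_quadratic] identifies [a t *: v t] as the derivative of
    [gamma] within the closed interval. *)
Lemma regular_control : exists v : R -> 'rV[R]_d,
  [/\ forall t, G t -> v t = u t,
      elipschitz_on [set: R] v,
      forall t, t0 <= t <= t1 -> enorm (v t) = 1 &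
      C1_on [set t | t0 <= t <= t1] gamma].
Proof.
have F10 := F1_ge0; have r0 := r_gt0; have K0 := Kmax_gt0.
have G0 : G !=set0.
  by have [s Gs _] := @G_dense t0 1 ltac:(by rewrite lexx ltW) ltr01; exists s.
have M0 : 0 <= 4 * F1 + 2 * Kmax / r by rewrite addr_ge0 ?mulr_ge0 ?invr_ge0// ltW.
have [v [M [M_ge0 vlip vE]]] := lipschitz_extension G0 M0 control_lipschitz_ae.
have vcont : forall e t, 0 < e -> exists2 del, 0 < del &
    forall s, `|s - t| < del -> enorm (v s - v t) < e.
  move=> e t e0; exists (e / (M + 1)); first by rewrite divr_gt0// ltr_wpDl.
  move=> s; rewrite ltr_pdivlMr ?ltr_wpDl// => h.
  apply: (le_lt_trans (vlip _ _)); apply: le_lt_trans h.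
  by rewrite mulrDr mulr1 mulrC lerDl.
exists v; split => //; first by exists M => s t _ _; exact: vlip.
  move=> t tI; apply/eqP; rewrite -subr_eq0 -normr_le0; apply/ler_addgt0Pr => e e0.
  have [del del0 H] := vcont e t e0.
  have [s Gs st] := G_dense tI del0.
  rewrite add0r -(control_unit Gs) -vE//.
  by apply: (le_trans (enorm_dist _ _)); rewrite enormB ltW// H.
exists (fun t => a t *: v t); split.
  apply: continuous_subspaceT => t; apply: cvgZ; first exact: a_cont.
  move=> N /nbhs_enormP[e e0 eN].
  have [del del0 H] := vcont e t e0.
  apply/nbhs_ballP; exists del => // s; rewrite /ball /= distrC => st.
  by apply: eN; exact: H.
move=> t tI N /nbhs_enormP[e e0 eN].
have [B [del1 [del10 H1]]] := gamma_quadratic M_ge0 vlip vE.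
have vt : 0 < enorm (v t) + 1 by rewrite ltr_wpDl ?enorm_ge0.
have e2 : 0 < e / 2 / (enorm (v t) + 1) by rewrite !divr_gt0.
have /is_derive_err/(_ _ e2)[del2 del20 H2] := A_der tI.
have B1 : 0 < `|B| + 1 by rewrite ltr_wpDl.
pose del := Num.min (Num.min del1 del2) (e / 2 / (`|B| + 1)).
have del0 : 0 < del by rewrite !lt_min del10 del20 !divr_gt0.
rewrite /within /= /dnbhs /within /=; apply/nbhs_ballP; exists del => // q.
rewrite /ball /= distrC !lt_min => /andP[/andP[q1 q2] q3] qt qI.
have h0 : 0 < `|q - t| by rewrite normr_gt0 subr_eq0.
have hn0 : q - t != 0 by rewrite -normr_gt0.
apply: eN.
have -> : (q - t)^-1 *: (gamma q - gamma t) - a t *: v t =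
  (q - t)^-1 *: ((gamma q - gamma t - (A q - A t) *: v t) + (A q - A t - (q - t) * a t) *: v t).
  by apply/rowP => j; rewrite !mxE; field.
rewrite enormZ normfV ltr_pdivrMl//; apply: (le_lt_trans (enormD _ _)).
have c1 := H1 t q tI qI q1; have c2 := H2 q q2.
have c3 : B * `|q - t| ^+ 2 < `|q - t| * (e / 2).
  rewrite expr2 mulrA mulrC ltr_pM2l//.
  apply: (@le_lt_trans _ _ (`|B| * `|q - t|)); first by rewrite ler_wpM2r// ler_norm.
  move: q3; rewrite ltr_pdivlMr// => q3; apply: le_lt_trans q3.
  by rewrite mulrDr mulr1 mulrC lerDl.
have c4 : enorm ((A q - A t - (q - t) * a t) *: v t) <= `|q - t| * (e / 2).
  rewrite enormZ; apply: (@le_trans _ _ (e / 2 / (enorm (v t) + 1) * `|q - t| * enorm (v t))).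
    by rewrite ler_wpM2r ?enorm_ge0.
  rewrite mulrAC mulrC ler_pM2l// mulrAC ler_pdivrMr// ler_pM2l ?divr_gt0//.
  by rewrite lerDl.
lra.
Qed.

End regularity.

(** * Exit times, and change of the control on a null set *)

Section exit_times.
Set Implicit Arguments.
Unset Strict Implicit.
Context {R : realType} {d : nat}.
Variables (Gamma : set 'rV[R]_d) (gamma : R -> 'rV[R]_d) (t0 : R).

Lemma exit_time_ge0 : (0 <= exit_time Gamma t0 gamma)%E.
Proof. by apply: le_ereal_inf_tmp => _ [t [tge0 _] <-]; rewrite lee_fin. Qed.

Lemma exit_time_attained (T : R) : closed Gamma -> 0 <= t0 ->
  elipschitz_on [set t | 0 <= t] gamma -> exit_time Gamma t0 gamma = T%:E ->
  Gamma (gamma (t0 + T)).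
Proof.
move=> cG t0_ge0 [M Mlip] TE; apply: cG => N /nbhs_enormP[e e0 eN].
have T0 : 0 <= T by rewrite -lee_fin -TE exit_time_ge0.
have M1 : 0 < `|M| + 1 by rewrite ltr_wpDl.
have : (exit_time Gamma t0 gamma < (T + e / (`|M| + 1))%:E)%E.
  by rewrite TE lte_fin ltrDl divr_gt0.
move=> /ereal_inf_lt[_ [t [tge0 tG] <-]]; rewrite lte_fin => tT.
have Tt : T <= t by rewrite -lee_fin -TE; apply: ereal_inf_lbound; exists t.
exists (gamma (t + t0)); split => //; apply: eN.
apply: (le_lt_trans (Mlip _ _ _ _)) => /=; rewrite ?addr_ge0//.
have -> : t + t0 - (t0 + T) = t - T by ring.
rewrite ger0_norm ?subr_ge0//.
apply: (@le_lt_trans _ _ ((`|M| + 1) * (t - T))).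
  by rewrite ler_wpM2r ?subr_ge0// (le_trans (ler_norm _))// lerDl.
by rewrite mulrC -ltr_pdivlMr// ltrBlDl.
Qed.

End exit_times.

Section almost_everywhere_density.
Set Implicit Arguments.
Unset Strict Implicit.
Context {R : realType}.

Lemma ae_witness (P : R -> Prop) (a b : R) : a < b ->
  {ae @lebesgue_measure R, forall t : R, P t} -> exists2 t, a < t < b & P t.
Proof.
move=> ab [N [mN N0 PN]]; apply: contrapT => nP.
have abN : `]a, b[ `<=` N.
  move=> t; rewrite /= in_itv /= => tab; apply: PN => /= Pt; apply: nP; by exists t.
have : (lebesgue_measure `]a, b[%classic <= lebesgue_measure N)%E.
  by apply: le_measure => //; rewrite inE.
by rewrite N0 lebesgue_measure_itv /= lte_fin ab lee_fin leNgt subr_gt0 ab.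
Qed.

End almost_everywhere_density.

Section control_modification.
Set Implicit Arguments.
Unset Strict Implicit.
Context {R : realType} {d : nat}.

Lemma elipschitz_continuous (w : R -> 'rV[R]_d) : elipschitz_on [set: R] w -> continuous w.
Proof.
move=> [M Mlip] t N /nbhs_enormP[e e0 eN].
have M1 : 0 < `|M| + 1 by rewrite ltr_wpDl.
apply/nbhs_ballP; exists (e / (`|M| + 1)); first by rewrite /= divr_gt0.
move=> s; rewrite /ball /= distrC ltr_pdivlMr// => st; apply: eN.
apply: (le_lt_trans (Mlip _ _ _ _)) => //; apply: le_lt_trans st.
by rewrite mulrC ler_wpM2l// (le_trans (ler_norm _))// lerDl.
Qed.

Lemma associated_control_patch (k : R -> 'rV[R]_d -> R) (gamma u w : R -> 'rV[R]_d) (t0 t1 : R) :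
  associated_control k gamma u -> 0 <= t0 -> t0 <= t1 -> elipschitz_on [set: R] w ->
  (forall t, t0 <= t <= t1 -> enorm (w t) <= 1) ->
  {ae @lebesgue_measure R, forall t : R, t0 <= t <= t1 -> w t = u t} ->
  let v t := if t0 <= t <= t1 then w t else u t in
  {ae @lebesgue_measure R, forall t : R, v t = u t} /\ associated_control k gamma v.
Proof.
move=> [umeas uball uder] t0_ge0 t01 wlip wball wu v.
have vu : {ae @lebesgue_measure R, forall t : R, v t = u t}.
  by apply: (ae_imply _ wu) => t wut; rewrite /v; case: ifPn => // /wut.
split=> //; split.
- move=> i.
  have DE : [set t : R | 0 <= t] = `[t0, t1]%classic `|` (`[0, t0[%classic `|` `]t1, +oo[%classic).
    apply/seteqP; split => t /=; rewrite !in_itv /= ?andbT.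
      move=> tge0; have [tt|tt] := ltP t t0; first by right; left; rewrite tge0.
      by have [tt'|tt'] := leP t t1; [left|right; right].
    case=> [/andP[/(le_trans t0_ge0)//]|[/andP[]//|/ltW]]; apply: le_trans.
    exact: le_trans t01.
  rewrite DE; apply: lebesgue_measurable_funU => //; first exact: measurableU.
    apply: (@eq_lebesgue_measurable_fun _ _ (fun t => w t ord0 i)).
      by move=> t; rewrite inE /= in_itv /= /v => ->.
    apply: borel_lebesgue_measurable_fun => //.
    apply: (measurable_funS (E := setT)) => //; apply: continuous_measurable_fun.
    move=> t; apply: (@continuous_comp _ _ _ w (fun x : 'rV[R]_d => x ord0 i)).
      exact: elipschitz_continuous.
    exact: coord_continuous.
  have sub A : measurable A -> A `<=` [set t : R | 0 <= t] -> (forall t, A t -> ~ (t0 <= t <= t1)) ->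
      lebesgue_measurable_fun A (fun t => v t ord0 i).
    move=> mA A0 nA; apply: (@eq_lebesgue_measurable_fun _ _ (fun t => u t ord0 i)).
      by move=> t; rewrite inE /v => /nA; case: ifP.
    by apply: lebesgue_measurable_funS (umeas i) => //; exact: measurable_nonneg.
  apply: lebesgue_measurable_funU => //; apply: sub => //.
  + by move=> t /=; rewrite in_itv /= => /andP[].
  + by move=> t /=; rewrite in_itv /= => /andP[_ h] /andP[]; rewrite leNgt h.
  + move=> t /=; rewrite in_itv /= andbT => /ltW; apply: le_trans.
    exact: le_trans t01.
  + by move=> t /=; rewrite in_itv /= andbT => h /andP[_]; rewrite leNgt h.
- by move=> t tge0; rewrite /v; case: ifPn => [/wball//|_]; exact: uball.
- apply: (ae_imply2 _ uder vu) => t h -> ; exact: h.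
Qed.

End control_modification.

Section travelled_length.
Set Implicit Arguments.
Unset Strict Implicit.
Context {R : realType} {d : nat}.

(** The inner product of [gamma] with its increment [e], minus [enorm e * A], is
    a Lipschitz function whose derivative is almost everywhere nonpositive. *)
Lemma gamma_increment (k : R -> 'rV[R]_d -> R) (gamma u : R -> 'rV[R]_d) (a A : R -> R) (Kmax : R) :
  associated_control k gamma u -> elipschitz_on [set t | 0 <= t] gamma ->
  (forall t, 0 <= t -> a t = k t (gamma t)) -> (forall t, 0 <= t -> 0 <= a t <= Kmax) ->
  (forall t : R, 0 <= t -> is_derive t (1 : R) A (a t)) ->
  forall s t, 0 <= s -> s <= t -> enorm (gamma t - gamma s) <= A t - A s.
Proof.
move=> [_ uball uder] [M Mlip] aE abd A_der s t s0 st.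
set e := gamma t - gamma s.
have e0 := enorm_ge0 e.
have Kmax0 : 0 <= Kmax by have /andP[] := abd 0 (lexx 0); exact: le_trans.
have A_lip x y : s <= x -> x <= y -> `|A x - A y| <= Kmax * `|x - y|.
  move=> sx xy; have [|z /andP[xz zy] E] := @mvt_cc R A a x y xy.
    by move=> z /andP[xz _]; apply: A_der; rewrite (le_trans s0)// (le_trans sx).
  have /andP[a1 a2] := abd z ltac:(by rewrite (le_trans s0)// (le_trans sx)).
  rewrite distrC E distrC normrM (ger0_norm a1) ler_wpM2r//.
have H : dot e (gamma t) - enorm e * A t <= dot e (gamma s) - enorm e * A s.
  pose H x := dot e (gamma x) - enorm e * A x.
  apply: (@lipschitz_ae_nonincreasing R H (enorm e * (`|M| + Kmax)) s t st).
  - by rewrite mulr_ge0// addr_ge0.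
  - have wl x y : s <= x -> x <= y -> `|H x - H y| <= enorm e * (`|M| + Kmax) * `|x - y|.
      move=> sx xy; have xge0 : 0 <= x by exact: le_trans sx.
      have -> : H x - H y = dot e (gamma x - gamma y) - enorm e * (A x - A y).
        by rewrite /H dotBr; ring.
      apply: (le_trans (ler_normB _ _)).
      rewrite [leRHS](_ : _ = enorm e * `|M| * `|x - y| + enorm e * Kmax * `|x - y|); last ring.
      apply: lerD.
        apply: (le_trans (dot_norm_le _ _)); rewrite -mulrA ler_wpM2l//.
        apply: (le_trans (Mlip _ _ xge0 (le_trans xge0 xy))).
        by rewrite ler_wpM2r// ler_norm.
      by rewrite normrM (ger0_norm e0) -mulrA ler_wpM2l// A_lip.
    move=> x y /andP[sx _] /andP[sy _]; have [xy|/ltW yx] := leP x y; first exact: wl.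
    by rewrite distrC (distrC x); exact: wl.
  - apply: (ae_imply _ uder) => x ux /andP[sx _].
    have xge0 : 0 <= x by rewrite (le_trans s0)// ltW.
    exists (dot e (k x (gamma x) *: u x) - enorm e * a x).
      have d1 := is_derive_dot e (ux xge0).
      have d2 := is_deriveZ (enorm e) (A_der x xge0).
      exact: (is_deriveB d1 d2).
    have /andP[a1 _] := abd x xge0.
    rewrite -aE// dotZr subr_le0 mulrC ler_wpM2r//.
    apply: (le_trans (dot_le _ _)); rewrite ler_piMr//; exact: uball.
have [/eqP ez|en] := eqVneq (enorm e) 0.
  rewrite (eqP ez) subr_ge0.
  have [|z /andP[sz _]] := @mvt_cc R A a s t st.
    by move=> z /andP[sz _]; apply: A_der; exact: le_trans sz.
  have /andP[a1 _] := abd z (le_trans s0 sz).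
  by move=> E; rewrite -subr_ge0 E mulr_ge0// subr_ge0.
have ep : 0 < enorm e by rewrite lt_neqAle eq_sym en.
rewrite -(@ler_pM2l _ (enorm e))// -expr2 enorm_sqr {2}/e dotBr mulrBr; lra.
Qed.

End travelled_length.

(** * The main result *)

Section speed_along.
Set Implicit Arguments.
Unset Strict Implicit.
Context {R : realType} {d : nat}.

Lemma bounded_closure_compact (A : set 'rV[R]_d) : bounded_set A -> compact (closure A).
Proof.
move=> bA; apply: bounded_closed_compact; last exact: closed_closure.
have [M [_ AM]] := bA.
exists M; split; first exact: num_real.
move=> M' MM' x /= Ax; apply/ler_addgt0Pr => e e0.
have [z [Az zx]] := Ax [set z | enorm (z - x) < e] ltac:(by apply/nbhs_enormP; exists e).
have -> : x = z - (z - x) by rewrite opprB addrC subrK.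
apply: (le_trans (ler_normB _ _)); apply: lerD.
  exact: AM MM' _ Az.
by apply: (le_trans (norm_le_enorm _)); exact: ltW.
Qed.

Lemma max0_dist (s t : R) : `|Num.max s 0 - Num.max t 0| <= `|s - t|.
Proof.
rewrite ler_norml; have := ler_norm (s - t); have := ler_norm (t - s).
rewrite (distrC t s) => h1 h2.
by have [] := leP s 0; have [] := leP t 0 => *; apply/andP; split; lra.
Qed.

(** Time is cut off at [0], to make the speed along [gamma] continuous on the
    whole line. *)
Lemma continuous_speed_along (Omega : set 'rV[R]_d) (k : R -> 'rV[R]_d -> R)
    (gamma : R -> 'rV[R]_d) :
  {within [set p : R * 'rV[R]_d | 0 <= p.1 /\ closure Omega p.2],
     continuous (fun p => k p.1 p.2)} ->
  (forall t, 0 <= t -> closure Omega (gamma t)) ->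
  elipschitz_on [set t | 0 <= t] gamma ->
  continuous (fun t : R => k (Num.max t 0) (gamma (Num.max t 0))).
Proof.
move=> kc gK [M Mlip] t.
have m0 (s : R) : 0 <= Num.max s 0 by rewrite le_max lexx orbT.
apply: (@speed_continuous R d Omega k kc (fun t => Num.max t 0) (fun t => gamma (Num.max t 0))).
- by apply: filterE => s; split; [exact: m0|exact: gK].
- apply/cvgrPdist_le => e e0; apply/nbhs_ballP; exists e => // s; rewrite /ball /= => st.
  by apply: (le_trans (max0_dist _ _)); exact: ltW.
- apply: elipschitz_continuous; exists `|M| => s s' _ _.
  apply: (le_trans (Mlip _ _ (m0 _) (m0 _))).
  apply: (@le_trans _ _ (`|M| * `|Num.max s 0 - Num.max s' 0|)).
    by rewrite ler_wpM2r// ler_norm.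
  by rewrite ler_wpM2l// max0_dist.
Qed.

End speed_along.

Theorem corollary4p9 (R : realType) (d : nat) (hd : (0 < d)%N)
    (Omega Gamma : set 'rV[R]_d)
    (Omega_nonempty : Omega !=set0) (Omega_open : open Omega)
    (Omega_bounded : bounded_set Omega) (Omega_connected : connected Omega)
    (bd_compact : compact (frontier Omega))
    (bd_C11 : C11_submanifold d.-1 (frontier Omega))
    (Gamma_sub : Gamma `<=` closure Omega)
    (Gamma_nonempty : Gamma !=set0) (Gamma_closed : closed Gamma)
    (k : R -> 'rV[R]_d -> R) (Kmin Kmax L : R)
    (k_continuous : {within [set p : R * 'rV[R]_d | 0 <= p.1 /\ closure Omega p.2],
                       continuous (fun p => k p.1 p.2)})
    (Kmin_gt0 : 0 < Kmin) (Kmax_gt0 : 0 < Kmax)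
    (k_bounds : forall t x, 0 <= t -> closure Omega x -> Kmin <= k t x <= Kmax)
    (L_gt0 : 0 < L)
    (k_lipschitz : forall t x1 x2, 0 <= t -> closure Omega x1 -> closure Omega x2 ->
       `|k t x1 - k t x2| <= L * enorm (x1 - x2))
    (t0 : R) (x0 : 'rV[R]_d) (t0_ge0 : 0 <= t0) (x0_in : closure Omega x0)
    (gamma : R -> 'rV[R]_d) (gamma_opt : Opt Omega Gamma k t0 x0 gamma)
    (T : \bar R) (T_def : T = value Omega Gamma k t0 x0)
    (u : R -> 'rV[R]_d) (u_control : associated_control k gamma u) :
  exists v : R -> 'rV[R]_d,
    [/\ {ae @lebesgue_measure R, forall t : R, 0 <= t -> v t = u t},
        associated_control k gamma v,
        C1_on (time_interval t0 T) gamma,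
        elipschitz_on (time_interval t0 T) v &
        forall t, time_interval t0 T t -> esphere (v t)].
Proof.
pose K := closure Omega.
have K_compact : compact K by exact: bounded_closure_compact.
have K_connected : connected K by exact: connected_closure.
have [C [r [C0 r0 bent]]] := uniform_bent_chord Omega_open hd bd_C11 K_compact.
have [gAdm g_const g_exit _] := gamma_opt.
have [gK g_lip _] := gAdm.
have g_t0 : gamma t0 = x0 by apply: g_const; rewrite t0_ge0 lexx.
have [z0 Gz0] := Gamma_nonempty.
have [c0 t0c0 rc0] := reach_everywhere k_continuous Kmin_gt0 k_bounds t0_ge0 x0_in r0 bent
  K_connected (Gamma_sub _ Gz0).
have T_le := reach_value t0c0 rc0 Gz0.
have T_ge0 : (0 <= T)%E by rewrite T_def -g_exit exit_time_ge0.
have [Tr TE] : exists Tr, T = Tr%:E.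
  have Tfin : T \is a fin_num.
    by rewrite ge0_fin_numE// T_def (le_lt_trans T_le)// ltry.
  by exists (fine T); rewrite fineK.
have Tr0 : 0 <= Tr by rewrite -lee_fin -TE.
pose t1 := t0 + Tr.
have t01 : t0 <= t1 by rewrite lerDl.
have intE t : time_interval t0 T t <-> t0 <= t <= t1.
  by rewrite /time_interval /= TE -EFinD lee_fin; split => [[-> ->]|/andP[-> ->]].
have g_target : Gamma (gamma t1).
  apply: (exit_time_attained Gamma_closed t0_ge0 g_lip).
  by rewrite g_exit -T_def TE.
have g_reach s : t0 <= s -> reach Omega k t0 x0 s (gamma s) by move=> _; exists gamma.
have no_early c : t0 <= c -> reach Omega k t0 x0 c (gamma t1) -> t1 <= c.
  move=> t0c rc; have := reach_value t0c rc g_target.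
  by rewrite -T_def TE lee_fin lerBrDl.
pose a (t : R) := k (Num.max t 0) (gamma (Num.max t 0)).
have aE t : 0 <= t -> a t = k t (gamma t) by move=> tge0; rewrite /a max_l.
have a_cont : continuous a by exact: (continuous_speed_along k_continuous gK g_lip).
have [A A_der] := continuous_antiderivative a_cont.
have A_der0 (t : R) : 0 <= t -> is_derive t (1 : R) A (a t).
  by move=> tge0; apply: A_der; apply: lt_le_trans tge0; rewrite ltrN10.
have a_bd t : 0 <= t -> Kmin <= a t <= Kmax.
  by move=> tge0; rewrite aE//; apply: k_bounds => //; exact: gK.
have gamma_A : forall s t, 0 <= s -> s <= t -> enorm (gamma t - gamma s) <= A t - A s.
  apply: (gamma_increment (Kmax := Kmax) u_control g_lip aE _ A_der0) => t tge0.
  by have /andP[h1 ->] := a_bd t tge0; rewrite (le_trans (ltW Kmin_gt0)).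
have [_ _ u_der] := u_control.
(* A representative with values defined on the whole line reduces the claim to the
   interval: outside it, [u] is kept. *)
suff [w [w_lip w_unit w_ae gC1]] : exists w : R -> 'rV[R]_d,
    [/\ elipschitz_on [set: R] w,
        forall t, t0 <= t <= t1 -> enorm (w t) = 1,
        {ae @lebesgue_measure R, forall t : R, t0 <= t <= t1 -> w t = u t} &
        C1_on [set t | t0 <= t <= t1] gamma].
  have w_ball t : t0 <= t <= t1 -> enorm (w t) <= 1 by move=> /w_unit ->.
  have [vu vc] := associated_control_patch u_control t0_ge0 t01 w_lip w_ball w_ae.
  exists (fun t => if t0 <= t <= t1 then w t else u t); split => //.
  - by apply: (ae_imply _ vu) => t -> .
  - by have -> : time_interval t0 T = [set t | t0 <= t <= t1] by apply/funext => t; exact/propext.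
  - have [M Mlip] := w_lip; exists M => s t /intE sI /intE tI.
    by rewrite sI tI; exact: Mlip.
  - by move=> t /intE tI; rewrite tI /esphere /=; exact: w_unit.
move: t01; rewrite le_eqVlt => /orP[/eqP t01|t01].
  (* The interval is a single point: any unit vector will do. *)
  exists (fun=> delta_mx ord0 (Ordinal hd)); split.
  - by exists 0 => s t _ _; rewrite subrr enorm0 mul0r.
  - move=> t _; apply/eqP; rewrite -sqrp_eq1 ?enorm_ge0// enorm_sqr dot_delta.
    by rewrite mxE !eqxx.
  - by apply: (ae_imply _ (ae_neq t0)) => t tt /andP[]; rewrite -t01 => h1 h2;
      move: tt; rewrite eq_le h1 h2.
  - exists (fun=> 0); split; first by apply: continuous_subspaceT => t; exact: cvg_cst.
    move=> t /andP[h1 h2] N _; have tt0 : t = t0 by apply/eqP; rewrite eq_le h1 t01 h2.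
    rewrite /within /= /dnbhs /within /=; apply/nbhs_ballP.
    exists 1 => //= s _ st /andP[s1 s2].
    by move: st; rewrite tt0 eq_le s1 t01 s2.
pose G := [set t : R | t0 < t < t1 /\ is_derive t (1 : R) gamma (a t *: u t)].
have G_ae : {ae @lebesgue_measure R, forall t : R, t0 < t < t1 -> G t}.
  apply: (ae_imply _ u_der) => t ut tI; split => //.
  have tge0 : 0 <= t by case/andP: tI => /ltW h _; exact: le_trans h.
  by rewrite aE//; exact: ut.
have G_dense t e : t0 <= t <= t1 -> 0 < e -> exists2 s, G s & `|s - t| < e.
  move=> /andP[tt0 tt1] e0.
  have lt : Num.max t0 (t - e) < Num.min t1 (t + e).
    by rewrite lt_min !gt_max t01/=; apply/andP; split; [lra|apply/andP; split; lra].
  have [s /andP[]] := ae_witness lt G_ae.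
  rewrite gt_max lt_min => /andP[s1 s2] /andP[s3 s4] Gs.
  exists s; first by apply: Gs; rewrite s1.
  by rewrite ltr_norml; apply/andP; split; lra.
pose F := L / Kmin + (C ^+ 2 + L / Kmin * C) + 1.
have F0 : 0 <= F.
  have LK : 0 < L / Kmin by rewrite divr_gt0.
  by rewrite /F addr_ge0// addr_ge0 ?(ltW LK)// addr_ge0 ?sqr_ge0// mulr_ge0// ltW.
have tpos s : t0 <= s -> 0 <= s by exact: le_trans.
have [|||||||||||w [wE w_lip w_unit gC1]] := @regular_control R d gamma u a A t0 t1 Kmin Kmax F r G
  Kmin_gt0 Kmax_gt0 F0 r0.
- by move=> s t h1 h2 _; exact: (A_bounds k_bounds gK aE A_der (tpos _ h1) h2).
- by move=> s t h1 h2 _; exact: gamma_A (tpos _ h1) h2.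
- by move=> t /andP[h1 _]; exact: A_der0 (tpos _ h1).
- by move=> s t x; exact: (gamma_chord k_continuous Kmin_gt0 k_bounds L_gt0 k_lipschitz
    t0_ge0 x0_in C0 r0 bent gK aE a_cont A_der gamma_A g_reach no_early).
- by move=> s t; exact: (chord_length k_continuous Kmin_gt0 k_bounds L_gt0 k_lipschitz
    t0_ge0 x0_in C0 r0 bent gK aE a_cont A_der gamma_A g_reach no_early).
- by move=> t [].
- exact: G_dense.
- by move=> t [].
- move=> t [/andP[/ltW h _] _]; have [_ uball _] := u_control.
  by exact: uball (tpos _ h).
- exact: t01.
- exact: a_cont.
exists w; split => //.
apply: (ae_imply3 _ G_ae (ae_neq t0) (ae_neq t1)) => t Gt nt0 nt1 /andP[h1 h2].
by apply: wE; apply: Gt; rewrite !lt_neqAle h1 h2 (eq_sym t0) nt0 nt1.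
Qed.
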